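(* Let $G$ be a non-elementary subgroup of $PU(1,n;\mathbb{C})$ which satisfies Condition A. Then $G$ is discrete if and only if for any two loxodromic elements $f,g\in G$ the group $\langle f,g\rangle$ is discrete.
   Context: $PU(1,n;\mathbb{C})$ ($n\ge 1$) is the projectivized group of linear automorphisms of $\mathbb{C}^{n+1}$ preserving a Hermitian form of signature $(1,n)$; it acts by holomorphic isometries on complex hyperbolic space $H^n_{\mathbb{C}}$ and continuously on its closure $\overline{H^n_{\mathbb{C}}}=H^n_{\mathbb{C}}\cup\partial H^n_{\mathbb{C}}$. It carries the topology induced from the matrix group; a subgroup is discrete if it is discrete in this topology, and $I$ denotes the identity. A non-trivial element $g$ is elliptic if it has a fixed point in $H^n_{\mathbb{C}}$; parabolic if it has exactly one fixed point in $\overline{H^n_{\mathbb{C}}}$ and it lies on $\partial H^n_{\mathbb{C}}$; loxodromic if it has exactly two fixed points in $\overline{H^n_{\mathbb{C}}}$ and both lie on $\partial H^n_{\mathbb{C}}$. A subgroup is non-elementary if it contains two non-elliptic elements of infinite order with distinct fixed points. For $g$, $\mathrm{fix}(g)=\{x\in\partial H^n_{\mathbb{C}}: g(x)=x\}$. A subgroup $G$ satisfies Condition A if there is no sequence $\{g_i\}$ of distinct elements of $G$ of finite order with $\mathrm{Card}(\mathrm{fix}(g_i))=\infty$ for all $i$ and $g_i\to I$. *)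

(* Defs.v *)
From HB Require Import structures.
From mathcomp Require Import all_boot all_order all_algebra.
From mathcomp Require Import complex.
From mathcomp Require Import reals.
Set Implicit Arguments. Unset Strict Implicit. Unset Printing Implicit Defensive.
Import Order.TTheory GRing.Theory Num.Theory.
Local Open Scope ring_scope.

Section PU.
Variable R : realType.
Local Notation C := (R[i]).
Variable n : nat.
Local Notation mx := ('M[C]_(n.+1)).
Local Notation vec := ('cV[C]_(n.+1)).

Definition Jmx : mx := \matrix_(i, j) (if i == j then (if i == 0 then -1 else 1) else 0).
Definition adjmx (m k : nat) (A : 'M[C]_(m, k)) : 'M[C]_(k, m) := (map_mx Num.conj A)^T.
Definition hform (z w : vec) : C := (adjmx w *m Jmx *m z) 0 0.

Definition in_U (A : mx) : Prop := adjmx A *m Jmx *m A = Jmx.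

(* Equality in PU(1,n) = U(1,n) / U(1) (unit scalars). *)
Definition pu_eq (A B : mx) : Prop := exists l : C, `|l| = 1 /\ A = l *: B.
Definition nontrivial (A : mx) : Prop := ~ pu_eq A 1.

(* A subgroup of PU(1,n) is represented by its full preimage in U(1,n):
   a subgroup of U(1,n) containing all unit scalars. *)
Definition is_PU_subgroup (S : mx -> Prop) : Prop :=
  (forall A, S A -> in_U A) /\ S 1 /\
  (forall A B, S A -> S B -> S (A *m B)) /\
  (forall A, S A -> S (invmx A)) /\
  (forall A l, S A -> `|l| = 1 -> S (l *: A)).

Definition gen (f g : mx) : mx -> Prop :=
  fun A => forall H, is_PU_subgroup H -> H f -> H g -> H A.

(* Points of the closure of complex hyperbolic space (projective model):
   lines spanned by nonzero vectors z with <z,z> <= 0;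
   H^n_C = negative lines, boundary = null lines. *)
Definition in_H (z : vec) : Prop := hform z z < 0.
Definition on_bd (z : vec) : Prop := z != 0 /\ hform z z = 0.
Definition in_closure (z : vec) : Prop := z != 0 /\ hform z z <= 0.
Definition proportional (z w : vec) : Prop := exists l : C, l != 0 /\ z = l *: w.

Definition fixes (A : mx) (z : vec) : Prop := exists l : C, A *m z = l *: z.

Definition fixcl (A : mx) (z : vec) : Prop := in_closure z /\ fixes A z.
Definition fixbd (A : mx) (z : vec) : Prop := on_bd z /\ fixes A z.

(* The (scaling-saturated) predicate P describes exactly k points (lines),
   all of which satisfy Q. *)
Definition exactly_points (k : nat) (P Q : vec -> Prop) : Prop :=
  exists s : seq vec, size s = k /\
    (forall z, z \in s -> P z /\ Q z) /\
    (forall i j, (i < k)%N -> (j < k)%N -> i <> j ->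
        ~ proportional (nth 0 s i) (nth 0 s j)) /\
    (forall z, P z -> exists2 w, w \in s & proportional z w).

Definition elliptic (A : mx) : Prop := nontrivial A /\ exists z, in_H z /\ fixes A z.
Definition parabolic (A : mx) : Prop := nontrivial A /\ exactly_points 1 (fixcl A) on_bd.
Definition loxodromic (A : mx) : Prop := nontrivial A /\ exactly_points 2 (fixcl A) on_bd.

Definition finite_order (A : mx) : Prop := exists k : nat, (0 < k)%N /\ pu_eq (A ^+ k) 1.
Definition infinite_order (A : mx) : Prop := ~ finite_order A.

Definition infinite_fix (A : mx) : Prop :=
  forall s : seq vec, exists z, fixbd A z /\ forall w, w \in s -> ~ proportional z w.

Definition non_elementary (S : mx -> Prop) : Prop :=
  exists f g, S f /\ S g /\ ~ elliptic f /\ ~ elliptic g /\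
    infinite_order f /\ infinite_order g /\ ~ (forall z, fixbd f z <-> fixbd g z).

(* Topology on PU(1,n): quotient of the matrix topology; [A] is eps-close to [B]
   iff some unit-scalar representative is entrywise eps-close. *)
Definition pu_close (A B : mx) (eps : R) : Prop :=
  exists l : C, `|l| = 1 /\ forall i j, `|l * A i j - B i j| < real_complex R eps.

Definition converges_to_I (g : nat -> mx) : Prop :=
  forall eps : R, 0 < eps -> exists N, forall i, (N <= i)%N -> pu_close (g i) 1 eps.

Definition discrete (S : mx -> Prop) : Prop :=
  forall B, S B -> exists eps : R, 0 < eps /\
    forall A, S A -> pu_close A B eps -> pu_eq A B.

Definition conditionA (S : mx -> Prop) : Prop :=
  ~ exists g : nat -> mx,
      (forall i, S (g i) /\ finite_order (g i) /\ infinite_fix (g i)) /\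
      (forall i j, i <> j -> ~ pu_eq (g i) (g j)) /\
      converges_to_I g.

End PU.

(* Main.v *)
(* Let [f] be loxodromic with fixed points [a, b], and let [g] lie in a discrete group containing
   [f]. If [g] is close enough to the identity (depending on [f] only), it fixes [a] and [b].
   Otherwise take, among the elements of the group not fixing both, one closest to the identity up
   to a factor 2; call it [g]. Commutators of [g] with small elements are much closer to the
   identity, so they fix [a] and [b]; by the same argument they act as a scalar on a long part of
   the orbit of [a], and comparing determinants on its span this scalar is 1. Hence [g] commutes,
   on [a], with [f^k g f^-k] for many [k], and by linear recurrence for all [k]. The growth rates of
   [f^k] then give [<ga,a> <gb,b> = 0], so [g] fixes [a] or [b], and discreteness forces it to fix
   the other point as well.

   If [G] is not discrete, take [g] in [G] close to the identity. The commutator of [g] and [f]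
   lies in the group generated by the loxodromic elements [f] and [g f g^-1], so it fixes [a] and
   [b], and hence so does [g]. Using two loxodromic elements, [g] fixes three boundary points, thus
   acts as a scalar on a complex geodesic and fixes infinitely many boundary points. It has finite
   order, since otherwise its powers, which are bounded, would accumulate in the discrete group
   generated by the loxodromic elements [f] and [f g]. This contradicts Condition A. Loxodromic
   elements exist because, for parabolic elements [f] and [g] with different fixed points, the
   traces of [f^k g] are unbounded. *)
Require Import Defs.
From HB Require Import structures.
From mathcomp Require Import all_boot all_order all_algebra.
From mathcomp Require Import complex reals boolp classical_sets filter.
From mathcomp Require Import ring lra.
Set Implicit Arguments. Unset Strict Implicit. Unset Printing Implicit Defensive.
Import Order.TTheory GRing.Theory Num.Theory.
Local Open Scope ring_scope.

(** * Entry-sum norm of complex matrices *)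

Section EntrySumNorm.
Variable R : realType.
Local Notation C := (R[i]).
Local Notation nc := (@Normc.normc R).

Lemma normc_norm (x : C) : `|x| = real_complex R (nc x). Proof. by []. Qed.

Lemma ncD (x y : C) : nc (x + y) <= nc x + nc y.
Proof. exact: le_normcD. Qed.

Lemma ncM (x y : C) : nc (x * y) = nc x * nc y.
Proof. exact: Normc.normcM. Qed.

Lemma ncV (x : C) : nc x^-1 = (nc x)^-1.
Proof. exact: Normc.normcV. Qed.

Lemma ncN (x : C) : nc (- x) = nc x.
Proof. exact: normcN. Qed.

Lemma nc0 : nc 0 = 0. Proof. exact: Normc.normc0. Qed.

Lemma nc1 : nc 1 = 1. Proof. exact: Normc.normc1. Qed.

Lemma nc_ge0 (x : C) : 0 <= nc x.
Proof. by rewrite -lecR -normc_norm normr_ge0. Qed.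

Lemma nc_eq0 (x : C) : (nc x == 0) = (x == 0).
Proof. by apply/eqP/eqP => [/Normc.eq0_normc //|->]; rewrite nc0. Qed.

Lemma nc_gt0 (x : C) : (0 < nc x) = (x != 0).
Proof. by rewrite lt_def nc_ge0 andbT nc_eq0. Qed.

Lemma ncJ (x : C) : nc x^* = nc x.
Proof. by apply: complexI; rewrite -!normc_norm norm_conjC. Qed.

Lemma ncB (x y : C) : nc (x - y) = nc (y - x).
Proof. by rewrite -ncN opprB. Qed.

Lemma nc_near1 (x : C) : `|nc x - 1| <= nc (x - 1).
Proof.
rewrite ler_norml; apply/andP; split.
  have := ncD (1 - x) x; rewrite subrK nc1 (ncB 1); lra.
by have := ncD (x - 1) 1; rewrite subrK nc1; lra.
Qed.

Lemma ncX (x : C) k : nc (x ^+ k) = nc x ^+ k.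
Proof. by elim: k => [|k IH]; rewrite ?expr0 ?nc1 // !exprS ncM IH. Qed.

Lemma ncR (x : R) : nc (real_complex R x) = `|x|.
Proof. by rewrite /= expr0n addr0 sqrtr_sqr. Qed.

Lemma nc_unit (x : C) : (`|x| == 1) = (nc x == 1).
Proof. by rewrite normc_norm; apply/eqP/eqP => [[]|->]. Qed.

Lemma nc_sq (x : C) : real_complex R (nc x ^+ 2) = x * x^*.
Proof. by rewrite -normCK normc_norm rmorphXn. Qed.

Lemma nc_sum (I : Type) (r : seq I) (P : pred I) (F : I -> C) :
  nc (\sum_(i <- r | P i) F i) <= \sum_(i <- r | P i) nc (F i).
Proof.
elim/big_rec2: _ => [|i y x _ h]; first by rewrite nc0.
by apply: (le_trans (ncD _ _)); rewrite lerD2l.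
Qed.

(** A submultiplicative norm, equivalent to the entrywise distance of [pu_close]. Its values lie in
    [R], so that real arithmetic applies. *)
Definition mn m k (A : 'M[C]_(m, k)) : R := \sum_i \sum_j nc (A i j).

Lemma mn_ge0 m k (A : 'M[C]_(m, k)) : 0 <= mn A.
Proof. by apply: sumr_ge0 => i _; apply: sumr_ge0 => j _; exact: nc_ge0. Qed.

Lemma mn_entry m k (A : 'M[C]_(m, k)) i j : nc (A i j) <= mn A.
Proof.
rewrite /mn (bigD1 i) //= (bigD1 j) //= -addrA lerDl addr_ge0 //.
  by apply: sumr_ge0 => ? _; exact: nc_ge0.
by apply: sumr_ge0 => ? _; apply: sumr_ge0 => ? _; exact: nc_ge0.
Qed.

Lemma mnD m k (A B : 'M[C]_(m, k)) : mn (A + B) <= mn A + mn B.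
Proof.
rewrite /mn -big_split /=; apply: ler_sum => i _.
by rewrite -big_split /=; apply: ler_sum => j _; rewrite mxE ncD.
Qed.

Lemma mnZ m k (c : C) (A : 'M[C]_(m, k)) : mn (c *: A) = nc c * mn A.
Proof.
rewrite /mn mulr_sumr; apply: eq_bigr => i _.
by rewrite mulr_sumr; apply: eq_bigr => j _; rewrite mxE ncM.
Qed.

Lemma mnN m k (A : 'M[C]_(m, k)) : mn (- A) = mn A.
Proof. by rewrite -scaleN1r mnZ ncN nc1 mul1r. Qed.

Lemma mnB m k (A B : 'M[C]_(m, k)) : mn (A - B) <= mn A + mn B.
Proof. by apply: (le_trans (mnD _ _)); rewrite mnN. Qed.

Lemma mn_eq0 m k (A : 'M[C]_(m, k)) : mn A = 0 -> A = 0.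
Proof.
move=> h; apply/matrixP => i j; rewrite mxE; apply/eqP; rewrite -nc_eq0.
by rewrite eq_le nc_ge0 -h mn_entry.
Qed.

Lemma mn_gt0 m k (A : 'M[C]_(m, k)) : A != 0 -> 0 < mn A.
Proof.
move=> h; rewrite lt_def mn_ge0 andbT.
by apply: contra h => /eqP /mn_eq0 ->.
Qed.

Lemma mnM m k p (A : 'M[C]_(m, k)) (B : 'M[C]_(k, p)) :
  mn (A *m B) <= mn A * mn B.
Proof.
rewrite /mn mulr_suml; apply: ler_sum => i _.
apply: (@le_trans _ _ (\sum_j \sum_l nc (A i l) * nc (B l j))).
  apply: ler_sum => j _; rewrite mxE; apply: (le_trans (nc_sum _ _ _)).
  by apply: ler_sum => l _; rewrite ncM.
rewrite exchange_big /= mulr_suml; apply: ler_sum => l _.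
rewrite -mulr_sumr ler_wpM2l ?nc_ge0 //.
rewrite [leRHS](bigD1 l) //= lerDl.
by apply: sumr_ge0 => ? _; apply: sumr_ge0 => ? _; exact: nc_ge0.
Qed.

Lemma mn_le m k (A : 'M[C]_(m, k)) (e : R) :
  (forall i j, nc (A i j) <= e) -> mn A <= (m * k)%:R * e.
Proof.
move=> h; apply: (@le_trans _ _ (\sum_(i < m) \sum_(j < k) e)).
  by apply: ler_sum => i _; apply: ler_sum => j _.
by rewrite !sumr_const !card_ord -mulrnA mulr_natl mulnC.
Qed.

Lemma mn_adj m k (A : 'M[C]_(m, k)) : mn (adjmx A) = mn A.
Proof.
rewrite /mn exchange_big /=; apply: eq_bigr => i _; apply: eq_bigr => j _.
by rewrite !mxE ncJ.
Qed.

End EntrySumNorm.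

(** * The Hermitian form of signature (1,n) *)

Section HermitianForm.
Variables (R : realType) (n : nat).
Local Notation C := (R[i]).
Local Notation nc := (@Normc.normc R).
Local Notation mx := ('M[C]_(n.+1)).
Local Notation vec := ('cV[C]_(n.+1)).
Local Notation J := (@Jmx R n).

Lemma rcD (x y : R) : real_complex R (x + y) = real_complex R x + real_complex R y.
Proof. exact: rmorphD. Qed.

Lemma rcM (x y : R) : real_complex R (x * y) = real_complex R x * real_complex R y.
Proof. exact: rmorphM. Qed.

Lemma adjmxM m k p (A : 'M[C]_(m, k)) (B : 'M[C]_(k, p)) :
  adjmx (A *m B) = adjmx B *m adjmx A.
Proof. by rewrite /adjmx map_mxM trmx_mul. Qed.

Lemma adjmxK m k (A : 'M[C]_(m, k)) : adjmx (adjmx A) = A.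
Proof. by apply/matrixP => i j; rewrite !mxE conjCK. Qed.

Lemma adjmx1 m : adjmx (1%:M : 'M[C]_m) = 1%:M.
Proof. by rewrite /adjmx map_mx1 trmx1. Qed.

Lemma Jmx_diag (A : 'M[C]_(n.+1, 1)) i :
  (J *m A) i 0 = (if i == 0 then -1 else 1) * A i 0.
Proof.
rewrite mxE (bigD1 i) //= mxE eqxx big1 ?addr0 // => j /negPf ji.
by rewrite mxE eq_sym ji mul0r.
Qed.

Lemma JmxK : J *m J = 1%:M.
Proof.
apply/matrixP => i j; rewrite mxE (bigD1 i) //= big1 ?addr0; last first.
  by move=> k /negPf ki; rewrite mxE eq_sym ki mul0r.
rewrite !mxE eqxx; case: (i == j); rewrite ?mulr0 //.
by case: ifP; rewrite ?mulrNN ?mul1r.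
Qed.

Lemma adjJ : adjmx J = J.
Proof.
apply/matrixP => i j; rewrite !mxE eq_sym; case: eqP => [->|]; last by rewrite conjC0.
by case: ifP => _; rewrite ?conjC1 ?rmorphN ?rmorph1.
Qed.

Lemma hformDl (x y w : vec) : hform (x + y) w = hform x w + hform y w.
Proof. by rewrite /hform mulmxDr mxE. Qed.

Lemma hformZl c (x w : vec) : hform (c *: x) w = c * hform x w.
Proof. by rewrite /hform -scalemxAr mxE. Qed.

Lemma hformC (z w : vec) : hform w z = (hform z w)^*.
Proof.
have -> : hform w z = adjmx (adjmx w *m J *m z) 0 0.
  by rewrite !adjmxM adjmxK adjJ mulmxA.
by rewrite {1}/adjmx [LHS]mxE [LHS]mxE.
Qed.

Lemma hformDr (x y w : vec) : hform w (x + y) = hform w x + hform w y.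
Proof. by rewrite [LHS]hformC hformDl rmorphD (hformC x) (hformC y). Qed.

Lemma hformZr c (x w : vec) : hform w (c *: x) = c^* * hform w x.
Proof. by rewrite [LHS]hformC hformZl rmorphM (hformC x). Qed.

Lemma hformNl (x w : vec) : hform (- x) w = - hform x w.
Proof. by rewrite -scaleN1r hformZl mulN1r. Qed.

Lemma hformNr (x w : vec) : hform w (- x) = - hform w x.
Proof. by rewrite [LHS]hformC hformNl rmorphN (hformC x). Qed.

Lemma hform0l (w : vec) : hform 0 w = 0.
Proof. by rewrite /hform mulmx0 mxE. Qed.

Lemma hformU (A : mx) (z w : vec) : in_U A -> hform (A *m z) (A *m w) = hform z w.
Proof.
by move=> hA; rewrite /hform adjmxM -!mulmxA (mulmxA J) (mulmxA _ (J *m A)) (mulmxA _ J) hA mulmxA.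
Qed.

Definition cJ : R := mn J.

Lemma nc_hform (z w : vec) : nc (hform z w) <= cJ * mn z * mn w.
Proof.
apply: (le_trans (mn_entry _ _ _)); apply: (le_trans (mnM _ _)).
have -> : cJ * mn z * mn w = mn w * cJ * mn z by ring.
by rewrite ler_wpM2r ?mn_ge0 // (le_trans (mnM _ _)) // mn_adj.
Qed.

Lemma hformE (z w : vec) :
  hform z w = - (z 0 0 * (w 0 0)^*) +
    \sum_(i < n) z (lift 0 i) 0 * (w (lift 0 i) 0)^*.
Proof.
rewrite /hform -mulmxA mxE big_ord_recl Jmx_diag /= !mxE; congr (_ + _).
  by ring.
by apply: eq_bigr => i _; rewrite Jmx_diag /= !mxE mul1r mulrC.
Qed.

(** The diagonal of the form is real; this is its value in [R], where signs and square roots are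
    handled. *)
Definition qf (z : vec) : R :=
  \sum_(i < n) nc (z (lift 0 i) 0) ^+ 2 - nc (z 0 0) ^+ 2.

Lemma hform_qf (z : vec) : hform z z = real_complex R (qf z).
Proof.
rewrite hformE rmorphB rmorph_sum /= addrC nc_sq; congr (_ - _).
by apply: eq_bigr => i _; rewrite nc_sq.
Qed.

Lemma hform_lt0 (z : vec) : (hform z z < 0) = (qf z < 0).
Proof. by rewrite hform_qf -[0]/(real_complex R 0) ltcR. Qed.

Lemma hform_le0 (z : vec) : (hform z z <= 0) = (qf z <= 0).
Proof. by rewrite hform_qf -[0]/(real_complex R 0) lecR. Qed.

Lemma hform_eq0 (z : vec) : (hform z z == 0) = (qf z == 0).
Proof. by rewrite hform_qf -[0]/(real_complex R 0) (inj_eq (@complexI R)). Qed.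

Lemma qfZ c (z : vec) : qf (c *: z) = nc c ^+ 2 * qf z.
Proof.
apply: (@complexI R); rewrite -hform_qf hformZl hformZr hform_qf mulrA -nc_sq.
by rewrite [RHS]rcM.
Qed.

Lemma qfU (A : mx) (z : vec) : in_U A -> qf (A *m z) = qf z.
Proof. by move=> hA; apply: (@complexI R); rewrite -!hform_qf hformU. Qed.

Lemma qf_space (w : vec) : w 0 0 = 0 -> forall i, nc (w i 0) ^+ 2 <= qf w.
Proof.
move=> w0 i; rewrite /qf w0 nc0 expr0n subr0.
case: (unliftP 0 i) => [j|] ->; last first.
  by rewrite w0 nc0 expr0n; apply: sumr_ge0 => j _; apply: sqr_ge0.
by rewrite (bigD1 j) //= lerDl; apply: sumr_ge0 => ? _; apply: sqr_ge0.
Qed.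

Lemma qf_space_ge0 (w : vec) : w 0 0 = 0 -> 0 <= qf w.
Proof. by move=> w0; apply: (le_trans _ (qf_space w0 0)); apply: sqr_ge0. Qed.

Lemma qf_space_eq0 (w : vec) : w 0 0 = 0 -> qf w <= 0 -> w = 0.
Proof.
move=> w0 hw; apply/matrixP => i j; rewrite (ord1 j) mxE; apply/eqP.
rewrite -nc_eq0 -sqrf_eq0; apply/eqP/le_anti; rewrite sqr_ge0 andbT.
exact: (le_trans (qf_space w0 i)).
Qed.

Lemma closure_neq0 (z : vec) : z != 0 -> qf z <= 0 -> z 0 0 != 0.
Proof. by move=> z0 hz; apply: contra z0 => /eqP h; apply/eqP/qf_space_eq0. Qed.

Lemma qf_sub (u z : vec) c :
  hform u z = 0 -> qf (u - c *: z) = qf u + nc c ^+ 2 * qf z.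
Proof.
move=> huz; apply: (@complexI R); rewrite -hform_qf.
rewrite !(hformDl, hformDr, hformNl, hformNr, hformZl, hformZr) huz.
rewrite (hformC u z) huz conjC0 !hform_qf [RHS]rcD [X in _ = _ + X]rcM.
by rewrite nc_sq; ring.
Qed.

(** Subtracting the multiple of [a] that kills the time coordinate does not change [qf x], as [a] is
    null and orthogonal to [x]. On vectors with zero time coordinate the form is positive definite,
    so the difference vanishes. *)
Lemma null_orth (a x : vec) : a != 0 -> qf a = 0 -> qf x <= 0 ->
  hform x a = 0 -> exists c, x = c *: a.
Proof.
move=> a0 qa qx h.
have a00 : a 0 0 != 0 by apply: closure_neq0 => //; rewrite qa.
exists (x 0 0 / a 0 0); apply/eqP; rewrite -subr_eq0; apply/eqP.
apply: qf_space_eq0; first by rewrite !mxE; field.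
by rewrite qf_sub // qa mulr0 addr0.
Qed.

Section OrthNegative.
Variables (z u : vec).
Hypotheses (hz : qf z < 0) (huz : hform u z = 0).

(* [w] has zero time coordinate, so the form is positive on it. *)
Let w : vec := u - (u 0 0 / z 0 0) *: z.

Let z00 : z 0 0 != 0.
Proof.
apply: closure_neq0; last exact: ltW.
by apply: contraTneq hz => ->; rewrite /qf big1 => [|i _]; rewrite mxE nc0 expr0n ?subr0 ?ltxx.
Qed.

Let w0 : w 0 0 = 0.
Proof. by rewrite !mxE; field. Qed.

Let quE : qf u = qf w + nc (u 0 0 / z 0 0) ^+ 2 * - qf z.
Proof. by rewrite qf_sub //; ring. Qed.

(** Put [c = u0 / z0]. Then [u = w + c z] and [qf u = qf w + |c|^2 |qf z|] with both terms
    nonnegative, so the square root of [qf u] controls [w] and [c]. *)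
Lemma orth_neg_bound i :
  nc (u i 0) <= Num.sqrt (qf u) * (1 + mn z / Num.sqrt (- qf z)).
Proof.
set s := Num.sqrt (- qf z).
have s0 : 0 < s by rewrite sqrtr_gt0 oppr_gt0.
have hc : nc (u 0 0 / z 0 0) <= Num.sqrt (qf u) / s.
  rewrite ler_pdivlMr // -[leLHS]ger0_norm ?mulr_ge0 ?nc_ge0 ?(ltW s0) //.
  rewrite -sqrtr_sqr ler_wsqrtr // exprMn sqr_sqrtr ?oppr_ge0 ?(ltW hz) //.
  by rewrite quE lerDr qf_space_ge0.
have hw : nc (w i 0) <= Num.sqrt (qf u).
  rewrite -[leLHS]ger0_norm ?nc_ge0 // -sqrtr_sqr ler_wsqrtr //.
  apply: (le_trans (qf_space w0 i)); rewrite quE lerDl mulr_ge0 ?sqr_ge0 //.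
  by rewrite oppr_ge0 ltW.
have -> : u i 0 = w i 0 + u 0 0 / z 0 0 * z i 0.
  by rewrite /w !mxE; ring.
apply: (le_trans (ncD _ _)); rewrite mulrDr mulr1 lerD // ncM.
rewrite mulrCA mulrC ler_pM ?nc_ge0 //; first exact: mn_entry.
Qed.

End OrthNegative.

End HermitianForm.

(** * Unitary matrices, subgroups, discreteness near the identity *)

Section GroupElements.
Variables (R : realType) (n : nat).
Local Notation C := (R[i]).
Local Notation nc := (@Normc.normc R).
Local Notation mx := ('M[C]_(n.+1)).
Local Notation vec := ('cV[C]_(n.+1)).
Local Notation J := (@Jmx R n).
Local Notation cJ := (@cJ R n).

Lemma invmx_of_mul1 (A B : mx) : A *m B = 1%:M -> invmx A = B.
Proof.
move=> h; have [hA _] := mulmx1_unit h.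
by rewrite -[invmx A]mulmx1; apply: (canLR (mulKmx hA)).
Qed.

Lemma invU_l (A : mx) : in_U A -> (J *m adjmx A *m J) *m A = 1%:M.
Proof. by move=> hA; rewrite -!mulmxA (mulmxA (adjmx A)) hA JmxK. Qed.

Lemma U_unit (A : mx) : in_U A -> A \in unitmx.
Proof. by move=> /invU_l /mulmx1_unit []. Qed.

Lemma invmxU (A : mx) : in_U A -> invmx A = J *m adjmx A *m J.
Proof.
move=> hA; have hu := U_unit hA.
by rewrite -[RHS]mulmx1 -(mulmxV hu) mulmxA invU_l // mul1mx.
Qed.

Lemma in_U1 : in_U (1%:M : mx).
Proof. by rewrite /in_U adjmx1 mul1mx mulmx1. Qed.

Lemma in_UM (A B : mx) : in_U A -> in_U B -> in_U (A *m B).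
Proof.
by move=> hA hB; rewrite /in_U adjmxM -!mulmxA (mulmxA J) (mulmxA (adjmx A)) (mulmxA (adjmx A)) hA mulmxA.
Qed.

Lemma in_UV (A : mx) : in_U A -> in_U (invmx A).
Proof.
move=> hA; have hu := U_unit hA; rewrite /in_U -{1}hA.
rewrite !mulmxA -adjmxM mulmxV // adjmx1 mul1mx -mulmxA.
by rewrite mulmxV // mulmx1.
Qed.

(** The inverse is the adjoint conjugated by [J], and the adjoint has the same norm. *)
Lemma mn_invmx (A : mx) : in_U A -> mn (invmx A) <= cJ ^+ 2 * mn A.
Proof.
move=> hA; rewrite invmxU //; apply: (le_trans (mnM _ _)).
rewrite expr2 -/cJ mulrAC ler_wpM2r ?mn_ge0 //.
by apply: (le_trans (mnM _ _)); rewrite mn_adj.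
Qed.

Lemma hformV (A : mx) (z w : vec) :
  in_U A -> hform (invmx A *m z) w = hform z (A *m w).
Proof.
move=> hA; rewrite -[RHS](hformU _ _ (in_UV hA)) mulmxA mulVmx ?mul1mx //.
exact: U_unit.
Qed.

Lemma pu_eq_fix (A B : mx) z : pu_eq A B -> fixes B z -> fixes A z.
Proof. by move=> [l [_ ->]] [m hm]; exists (l * m); rewrite -scalemxAl hm scalerA. Qed.

Lemma fix1 (z : vec) : fixes (1%:M : mx) z.
Proof. by exists 1; rewrite mul1mx scale1r. Qed.

Lemma fixM (A B : mx) z : fixes A z -> fixes B z -> fixes (A *m B) z.
Proof.
move=> [l hl] [m hm]; exists (m * l).
by rewrite -mulmxA hm -scalemxAr hl scalerA.
Qed.

Lemma fixX (A : mx) z k : fixes A z -> fixes (A ^+ k) z.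
Proof.
move=> h; elim: k => [|k IH]; first by rewrite expr0; exact: fix1.
by rewrite exprS; apply: fixM.
Qed.

Lemma unit_mul_neq0 (A : mx) (z : vec) : A \in unitmx -> z != 0 -> A *m z != 0.
Proof.
move=> hA; apply: contra => /eqP h.
by rewrite -[z]mul1mx -(mulVmx hA) -mulmxA h mulmx0.
Qed.

Lemma fixV (A : mx) z : A \in unitmx -> fixes A z -> fixes (invmx A) z.
Proof.
move=> hA [l hl]; have [->|z0] := eqVneq z 0; first by exists 0; rewrite mulmx0 scaler0.
have l0 : l != 0.
  by apply/eqP => l0; move: (unit_mul_neq0 hA z0); rewrite hl l0 scale0r eqxx.
exists l^-1; apply: (canLR (mulKmx hA)).
by rewrite -scalemxAr hl scalerA mulVf // scale1r.
Qed.

Lemma fix_conj (A B : mx) z : B \in unitmx ->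
  fixes (invmx B *m A *m B) z -> fixes A (B *m z).
Proof.
move=> hB [l hl]; exists l.
by rewrite scalemxAr -hl !mulmxA mulmxV // mul1mx.
Qed.

Lemma fixZ (A : mx) (z : vec) c : fixes A z -> fixes A (c *: z).
Proof. by move=> [l hl]; exists l; rewrite -scalemxAr hl !scalerA mulrC. Qed.

Section Subgroup.
Variable S : mx -> Prop.
Hypothesis hS : is_PU_subgroup S.

Lemma sgU (A : mx) : S A -> in_U A. Proof. by case: hS => h _; exact: h. Qed.

Lemma sg1 : S 1%:M. Proof. by case: hS => _ []. Qed.

Lemma sgM (A B : mx) : S A -> S B -> S (A *m B).
Proof. by case: hS => _ [_ [h _]]; exact: h. Qed.

Lemma sgV (A : mx) : S A -> S (invmx A).
Proof. by case: hS => _ [_ [_ [h _]]]; exact: h. Qed.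

Lemma sgZ l (A : mx) : S A -> `|l| = 1 -> S (l *: A).
Proof. by case: hS => _ [_ [_ [_ h]]]; exact: h. Qed.

Lemma sgX (A : mx) k : S A -> S (A ^+ k).
Proof.
move=> hA; elim: k => [|k IH]; first by rewrite expr0; exact: sg1.
by rewrite exprS; apply: sgM.
Qed.

End Subgroup.

Lemma in_UX (A : mx) k : in_U A -> in_U (A ^+ k).
Proof.
move=> hA; elim: k => [|k IH]; first by rewrite expr0; exact: in_U1.
by rewrite exprS; apply: in_UM.
Qed.

Lemma in_UZ (A : mx) l : `|l| = 1 -> in_U A -> in_U (l *: A).
Proof.
move=> hl hA; rewrite /in_U.
have -> : adjmx (l *: A) = l^* *: adjmx A.
  by apply/matrixP => i j; rewrite !mxE rmorphM.
rewrite -!scalemxAl -scalemxAr scalerA hA.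
by rewrite mulrC -normCK hl expr1n scale1r.
Qed.

Lemma gen_subgroup (f g : mx) : in_U f -> in_U g -> is_PU_subgroup (gen f g).
Proof.
move=> hf hg; split; last split; last split; last split.
(* The whole unitary group is one of the subgroups over which [gen] intersects. *)
- move=> A; apply=> //; split; first by [].
  split; first exact: in_U1.
  split; first exact: in_UM.
  by split; [exact: in_UV | move=> B l hB hl; exact: in_UZ].
- by move=> H hH _ _; exact: sg1.
- by move=> A B hA hB H hH h1 h2; apply: sgM => //; [apply: hA | apply: hB].
- by move=> A hA H hH h1 h2; apply: sgV => //; apply: hA.
- by move=> A l hA hl H hH h1 h2; apply: sgZ => //; apply: hA.
Qed.

Lemma gen_l (f g : mx) : gen f g f. Proof. by move=> H. Qed.

Lemma gen_r (f g : mx) : gen f g g. Proof. by move=> H. Qed.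

Lemma pu_close_of_near (A B : mx) e : mn (A - B) < e -> pu_close A B e.
Proof.
move=> h; exists 1; split=> [|i j]; first exact: normr1.
rewrite mul1r normc_norm ltcR; apply: le_lt_trans h.
by have := mn_entry (A - B) i j; rewrite !mxE.
Qed.

Lemma near_of_pu_close (A B : mx) e : 0 < e -> pu_close A B e ->
  exists l, `|l| = 1 /\ mn (l *: A - B) <= (n.+1 * n.+1)%:R * e.
Proof.
move=> e0 [l [hl h]]; exists l; split=> //; apply: mn_le => i j.
by have := h i j; rewrite normc_norm ltcR !mxE => /ltW.
Qed.

(** Unit scalars do not change moduli, so no limit of scalars has to be taken: off-diagonal entries,
    differences of diagonal entries, and the deviation of a diagonal modulus from 1 are each below
    every [e]. *)
Lemma pu_close_all (A : mx) : (forall e : R, 0 < e -> pu_close A 1 e) -> pu_eq A 1.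
Proof.
move=> h.
have hoff i j : i != j -> A i j = 0.
  move=> ij; apply/eqP; rewrite -nc_eq0; apply/eqP/le_anti; rewrite nc_ge0 andbT.
  apply/ler_addgt0Pl => e; move: (e : R) => {}e e0; have [l [hl /(_ i j)]] := h e e0.
  rewrite !mxE (negPf ij) subr0 normc_norm ltcR ncM.
  by have /eqP := hl; rewrite nc_unit => /eqP ->; rewrite mul1r addr0 => /ltW.
have hdiag i j : A i i = A j j.
  apply/eqP; rewrite -subr_eq0 -nc_eq0; apply/eqP/le_anti; rewrite nc_ge0 andbT.
  apply/ler_addgt0Pl => e; move: (e : R) => {}e e0.
  have [|l [hl hh]] := h (e / 2); first by rewrite divr_gt0.
  have hl1 : nc l = 1 by apply/eqP; rewrite -nc_unit; apply/eqP.
  have := hh i i; have := hh j j; rewrite !mxE !eqxx !normc_norm !ltcR => h1 h2.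
  rewrite -[nc _]mul1r -hl1 -ncM.
  have -> : l * (A i i - A j j) = (l * A i i - 1) - (l * A j j - 1) by ring.
  apply: (le_trans (ncD _ _)); rewrite ncN addr0; lra.
have hA : A = A 0 0 *: 1.
  apply/matrixP => i j; rewrite !mxE; case: eqP => [->|/eqP]; last first.
    by move=> ij; rewrite mulr0 hoff.
  by rewrite mulr1 (hdiag j 0).
exists (A 0 0); split=> //; apply/eqP; rewrite nc_unit -subr_eq0 -normr_eq0.
apply/eqP/le_anti; rewrite normr_ge0 andbT; apply/ler_addgt0Pl => e; move: (e : R) => {}e e0.
have [l [hl /(_ 0 0)]] := h e e0; rewrite !mxE eqxx mulr1n normc_norm ltcR addr0 => h1.
have hl1 : nc l = 1 by apply/eqP; rewrite -nc_unit; apply/eqP.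
have hA0 : nc (A 0 0) = nc (l * A 0 0) by rewrite ncM hl1 mul1r.
by rewrite hA0; exact: (le_trans (nc_near1 _) (ltW h1)).
Qed.

Lemma discrete_near1 (S : mx -> Prop) : is_PU_subgroup S -> discrete S ->
  exists e : R, 0 < e /\ forall A, S A -> mn (A - 1%:M) < e -> pu_eq A 1.
Proof.
move=> hS /(_ 1%:M (sg1 hS)) [e [e0 h]]; exists e; split=> // A hA hn.
by apply: h => //; exact: pu_close_of_near.
Qed.

(** Elements accumulating at [B] are translated to the identity by the inverse of [B]. *)
Lemma not_discrete_near1 (S : mx -> Prop) : is_PU_subgroup S -> ~ discrete S ->
  forall e : R, 0 < e -> exists A, [/\ S A, mn (A - 1%:M) < e & ~ pu_eq A 1].
Proof.
move=> hS hd e e0; apply: contrapT => hno; apply: hd => B hB.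
have hBU := sgU hS hB; have hBu := U_unit hBU.
set M : R := mn (invmx B) + 1.
have M0 : 0 < M by rewrite ltr_wpDl ?mn_ge0.
set N : R := (n.+1 * n.+1)%:R.
have N0 : 0 < N by rewrite ltr0n.
(* [N] converts entrywise closeness into [mn], [M] pays for the inverse of [B], and the factor 2
   makes the bound strict. *)
exists (e / (2 * M * N)); split; first by rewrite !divr_gt0 ?mulr_gt0.
move=> A hA /near_of_pu_close [|l [hl hn]]; first by rewrite !divr_gt0 ?mulr_gt0.
apply: contrapT => hne; apply: hno.
exists (invmx B *m (l *: A)); split.
- by apply: sgM => //; [exact: sgV | exact: sgZ].
- have -> : invmx B *m (l *: A) - 1%:M = invmx B *m (l *: A - B).
    by rewrite mulmxBr mulVmx.
  apply: (le_lt_trans (mnM _ _)).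
  apply: (@le_lt_trans _ _ (M * (N * (e / (2 * M * N))))).
    by apply: ler_pM; rewrite ?mn_ge0 // lerDl.
  have -> : M * (N * (e / (2 * M * N))) = e / 2.
    by have := lt0r_neq0 M0; have := lt0r_neq0 N0; generalize M N => x y hx hy; field; rewrite hx hy.
  by rewrite ltr_pdivrMr // ltr_pMr // ltr1n.
- move=> [c [hc h]]; apply: hne; exists (l^-1 * c); split.
    by rewrite normrM normrV ?unitfE -?normr_gt0 hl // hc invr1 mulr1.
  have l0 : l != 0 by rewrite -normr_gt0 hl.
  rewrite -scalerA; apply: (canRL (scalerK l0)).
  rewrite -[l *: A]mul1mx -(mulmxV hBu) -mulmxA h.
  by rewrite -scalemxAr mulmx1.
Qed.

End GroupElements.

(** * Cluster points by ultrafilters *)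

Section ClusterPoints.
Variable R : realType.
Local Notation C := (R[i]).
Local Notation nc := (@Normc.normc R).

(** The limit is the supremum of the [r] with [r <= u k] for [U]-almost all [k]; the ultrafilter
    decides on which side of each threshold the sequence lies. *)
Lemma ultra_limit (U : set_system nat) (hU : UltraFilter U) (u : nat -> R) (M : R) :
  (forall k, `|u k| <= M) ->
  exists l, forall e, 0 < e -> U [set k | `|u k - l| < e]%classic.
Proof.
move=> hM; pose E : set R := [set r | U [set k | r <= u k]]%classic.
have hE : has_sup E.
  split.
    exists (- M); rewrite /E /=.
    have -> : [set k | - M <= u k]%classic = setT.
      by apply/seteqP; split=> k //= _; have := hM k; rewrite ler_norml => /andP[].
    exact: filterT.
  exists M => r; rewrite /E /= => hr.
  have [k /= hk] := filter_ex hr; apply: (le_trans hk).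
  by have := hM k; rewrite ler_norml => /andP[].
exists (sup E) => e e0.
have h1 : U [set k | u k < sup E + e]%classic.
  have [h|] := in_ultra_setVsetC [set k | sup E + e <= u k]%classic hU.
    have := ub_le_sup hE.2 h.
    by rewrite gerDl leNgt e0.
  by apply: filterS => k /= /negP; rewrite ltNge.
have [r hr her] := sup_adherent e0 hE.
have {}hr : U [set k | r <= u k]%classic by [].
apply: (filterS _ (filterI h1 hr)) => k /= [ha hb].
by rewrite ltr_norml; apply/andP; split; lra.
Qed.

Lemma ultra_limit_complex (U : set_system nat) (hU : UltraFilter U) (u : nat -> C) (M : R) :
  (forall k, nc (u k) <= M) ->
  exists l, forall e, 0 < e -> U [set k | nc (u k - l) < e]%classic.
Proof.
move=> hM.
have hRe (x : C) : `|complex.Re x| <= nc x.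
  by rewrite -lecR -normc_norm normc_ge_Re.
have hIm (x : C) : `|complex.Im x| <= nc x.
  case: x => a b /=; rewrite -sqrtr_sqr ler_wsqrtr // lerDr sqr_ge0 //.
have hle (x : C) : nc x <= `|complex.Re x| + `|complex.Im x|.
  case: x => a b /=; rewrite -[leRHS]ger0_norm ?addr_ge0 ?normr_ge0 //.
  rewrite -sqrtr_sqr ler_wsqrtr // sqrrD !real_normK ?num_real //.
  by rewrite addrAC lerDl mulrn_wge0 // mulr_ge0.
have [|x hx] := ultra_limit hU (u := fun k => complex.Re (u k)) (M := M).
  by move=> k; apply: (le_trans (hRe _)).
have [|y hy] := ultra_limit hU (u := fun k => complex.Im (u k)) (M := M).
  by move=> k; apply: (le_trans (hIm _)).
exists (Complex x y) => e e0.
have e2 : 0 < e / 2 by rewrite divr_gt0.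
apply: (filterS _ (filterI (hx _ e2) (hy _ e2))) => k /= [ha hb].
apply: (le_lt_trans (hle _)); move: ha hb.
case: (u k) => a b /= ha hb; lra.
Qed.

(** One ultrafilter finer than the eventual filter gives limits for all entries at once, instead of
    successive subsequences; being finer, it provides indices beyond any [K]. *)
Lemma bounded_cluster m p (A : nat -> 'M[C]_(m, p)) (M : R) :
  (forall k, mn (A k) <= M) ->
  exists P, forall e, 0 < e -> forall K, exists k, (K <= k)%N /\ mn (A k - P) < e.
Proof.
move=> hM; have [U [hU hoo]] := ultraFilterLemma eventually_filter.
have hlim ij : exists l, forall e, 0 < e ->
    U [set k | nc (A k ij.1 ij.2 - l) < e]%classic.
  apply: (@ultra_limit_complex U hU _ M) => k.
  exact: (le_trans (mn_entry _ _ _)).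
have [l hl] := choice hlim.
exists (\matrix_(i, j) l (i, j)) => e e0 K.
(* The successor keeps the divisor positive for empty matrices and makes the last inequality
   strict. *)
set N : R := (m * p).+1%:R.
have N0 : 0 < N by rewrite ltr0n.
have e1 : 0 < e / N by rewrite divr_gt0.
have hall : U [set k | forall ij, nc (A k ij.1 ij.2 - l ij) < e / N]%classic.
  by apply: filter_forall => ij; exact: hl.
have hK : U [set k | (K <= k)%N]%classic by apply: hoo; exists K.
have [k [/= h1 h2]] := filter_ex (filterI hall hK).
exists k; split=> //; apply: le_lt_trans (mn_le (e := e / N) _) _.
  by move=> i j; rewrite !mxE; apply/ltW; exact: (h1 (i, j)).
rewrite mulrCA gtr_pMr // ltr_pdivrMr // mul1r ltr_nat //.
Qed.

End ClusterPoints.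

(** * Bounded sequences in a discrete group *)

Section Recurrence.
Variables (R : realType) (n : nat).
Local Notation C := (R[i]).
Local Notation mx := ('M[C]_(n.+1)).
Local Notation cJ := (@cJ R n).

(** Two terms near a common cluster point have a quotient near the identity, since inverses stay
    bounded; discreteness makes this quotient a unit scalar. *)
Lemma discrete_bounded_repeats (S : mx -> Prop) (t : nat -> mx) (M : R) :
  is_PU_subgroup S -> discrete S -> (forall k, S (t k)) ->
  (forall k, mn (t k) <= M) ->
  exists i j, (i < j)%N /\ pu_eq (t j) (t i).
Proof.
move=> hS hd ht hM; have [e [e0 he]] := discrete_near1 hS hd.
have [P hP] := bounded_cluster hM.
set L : R := cJ ^+ 2 * M + 1.
have L0 : 0 < L.
  rewrite ltr_wpDl // mulr_ge0 ?sqr_ge0 //.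
  exact: (le_trans (mn_ge0 (t 0%N))).
have e1 : 0 < e / (2 * L) by rewrite divr_gt0 ?mulr_gt0.
have [i [_ hi]] := hP _ e1 0%N; have [j [hij hj]] := hP _ e1 i.+1.
have hUi := sgU hS (ht i); have hui := U_unit hUi.
exists i, j; split=> //.
have [||l [hl h]] := he (invmx (t i) *m t j).
- by apply: sgM => //; apply: sgV.
- have -> : invmx (t i) *m t j - 1%:M = invmx (t i) *m ((t j - P) - (t i - P)).
    by rewrite opprB addrA subrK mulmxBr mulVmx.
  apply: (le_lt_trans (mnM _ _)).
  apply: (@le_lt_trans _ _ (L * mn (t j - P - (t i - P)))).
    rewrite ler_wpM2r ?mn_ge0 //; apply: (le_trans (mn_invmx hUi)).
    apply: (@le_trans _ _ (cJ ^+ 2 * M)); last by rewrite lerDl.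
    by rewrite ler_wpM2l ?sqr_ge0.
  rewrite -ltr_pdivlMl //; apply: (le_lt_trans (mnB _ _)).
  have -> : L^-1 * e = e / (2 * L) + e / (2 * L).
    by have := lt0r_neq0 L0; generalize L => x hx; field.
  exact: ltrD.
exists l; split=> //.
by rewrite -[t j]mul1mx -(mulmxV hui) -mulmxA h -scalemxAr mulmx1.
Qed.

End Recurrence.

(** * Eigenvectors and loxodromic axes *)

Section LoxodromicAxes.
Variables (R : realType) (n : nat).
Local Notation C := (R[i]).
Local Notation nc := (@Normc.normc R).
Local Notation mx := ('M[C]_(n.+1)).
Local Notation vec := ('cV[C]_(n.+1)).
Local Notation J := (@Jmx R n).

Lemma conjV (l : C) : (l^-1)^* = (l^*)^-1.
Proof. exact: fmorphV. Qed.

Lemma conjM (x y : C) : (x * y)^* = x^* * y^*.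
Proof. exact: rmorphM. Qed.

Lemma dualK (l : C) : (((l^*)^-1)^*)^-1 = l.
Proof. by rewrite conjV conjCK invrK. Qed.

Lemma hform_nondeg (v : vec) : (forall x, hform x v = 0) -> v = 0.
Proof.
move=> h; have hW : adjmx v *m J = 0.
  apply/matrixP => i j; rewrite (ord1 i) [RHS]mxE.
  have -> : (adjmx v *m J) 0 j = (adjmx v *m J *m (delta_mx j 0 : vec)) 0 0.
    by rewrite -colE [RHS]mxE.
  exact: h.
have : adjmx v = 0 by rewrite -[LHS]mulmx1 -JmxK mulmxA hW mul0mx.
move=> h0; rewrite -[v]adjmxK h0.
by apply/matrixP => i j; rewrite !mxE conjC0.
Qed.

Lemma col_kernel (A : mx) : A \notin unitmx -> exists2 y : vec, y != 0 & A *m y = 0.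
Proof.
rewrite unitmxE unitfE negbK -det_tr => /det0P [v v0 hv].
exists v^T; first by rewrite -(inj_eq trmx_inj) trmxK trmx0.
by apply: trmx_inj; rewrite trmx_mul trmxK hv trmx0.
Qed.

Lemma neg_neq0 (z : vec) : qf z < 0 -> z != 0.
Proof.
by apply: contraTneq => ->; rewrite /qf big1 => [|i _]; rewrite mxE nc0 expr0n ?subr0 ?ltxx.
Qed.

(** By invariance of [hform x y]. This duality between eigenvalues of non-orthogonal eigenvectors is
    the basic tool for comparing boundary fixed points. *)
Lemma eigen_pair (A : mx) (x y : vec) l m : in_U A ->
  A *m x = l *: x -> A *m y = m *: y -> hform x y != 0 -> l * m^* = 1.
Proof.
move=> hA hx hy h; apply: (mulIf h); rewrite mul1r -{2}(hformU _ _ hA) hx hy.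
by rewrite hformZl hformZr mulrA.
Qed.

Lemma eigen_neq0 (A : mx) (x : vec) l : in_U A -> x != 0 -> A *m x = l *: x -> l != 0.
Proof.
move=> /U_unit hA x0 hx; apply/eqP => l0.
by move: (unit_mul_neq0 hA x0); rewrite hx l0 scale0r eqxx.
Qed.

Lemma eigenV (A : mx) (x : vec) l : in_U A -> A *m x = l *: x ->
  invmx A *m x = l^-1 *: x.
Proof.
move=> hA hx; have hu := U_unit hA.
have [->|x0] := eqVneq x 0; first by rewrite mulmx0 scaler0.
have l0 := eigen_neq0 hA x0 hx.
apply: (canLR (mulKmx hu)).
by rewrite -scalemxAr hx scalerA mulVf // scale1r.
Qed.

Lemma eigenX (A : mx) (x : vec) l k : A *m x = l *: x ->
  A ^+ k *m x = l ^+ k *: x.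
Proof.
move=> hx; elim: k => [|k IH]; first by rewrite !expr0 mul1mx scale1r.
by rewrite exprSr -mulmxA hx -scalemxAr IH scalerA -exprS.
Qed.

Lemma hform_orthC (x y : vec) : hform x y = 0 -> hform y x = 0.
Proof. by move=> h; rewrite hformC h conjC0. Qed.

Lemma hform_neq0C (x y : vec) : hform x y != 0 -> hform y x != 0.
Proof. by apply: contra => /eqP /hform_orthC ->. Qed.

Lemma on_bdP (z : vec) : on_bd z <-> z != 0 /\ qf z = 0.
Proof.
split=> -[z0 h]; split=> //; first by apply/eqP; rewrite -hform_eq0 h.
by apply/eqP; rewrite hform_eq0 h.
Qed.

Lemma eigen_mod_null (A : mx) (x : vec) l : in_U A -> A *m x = l *: x ->
  nc l != 1 -> qf x = 0.
Proof.
move=> hA hx hl; have := qfU x hA; rewrite hx qfZ => /eqP.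
rewrite -subr_eq0 -{2}[qf x]mul1r -mulrBl mulf_eq0 => /orP[|/eqP //].
rewrite subr_sqr_1 mulf_eq0 subr_eq0 (negPf hl) /= => /eqP h.
by have := nc_ge0 l; lra.
Qed.

(** [a] is the attracting end and [b] the repelling one. The eigenvalue at [b] is forced by
    [eigen_pair], so [l] records both. *)
Definition lox_axis (A : mx) (a b : vec) (l : C) : Prop :=
  [/\ on_bd a, on_bd b, hform a b != 0, 1 < nc l &
      A *m a = l *: a /\ A *m b = (l^*)^-1 *: b].

Lemma closure_orth_null (a z : vec) : on_bd a -> z != 0 -> qf z <= 0 ->
  hform z a = 0 -> exists2 c, c != 0 & z = c *: a.
Proof.
move=> /on_bdP [a0 qa] z0 qz h; have [c hc] := null_orth a0 qa qz h.
by exists c => //; apply: contra z0 => /eqP c0; rewrite hc c0 scale0r.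
Qed.

(** With [m] the inverse conjugate of [l], the range of [A - m] is orthogonal to [v]. By
    nondegeneracy it is a proper subspace, hence [A - m] has a kernel. *)
Lemma dual_eigenvector (A : mx) (v : vec) l : in_U A -> v != 0 ->
  A *m v = l *: v -> exists2 y : vec, y != 0 & A *m y = (l^*)^-1 *: y.
Proof.
move=> hA v0 hv; have l0 := eigen_neq0 hA v0 hv.
set m := (l^*)^-1.
have hnu : A - m%:M \notin unitmx.
  apply/negP => hu; move/eqP: v0; apply; apply: hform_nondeg => x.
  rewrite -[x](mulKVmx hu); set y := invmx _ *m x.
  rewrite mulmxBl mul_scalar_mx hformDl hformNl hformZl.
  rewrite -[A]invmxK hformV; last exact: in_UV.
  by rewrite (eigenV hA hv) hformZr conjV subrr.
have [y y0 hy] := col_kernel hnu; exists y => //.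
by apply/eqP; rewrite -subr_eq0 -hy mulmxBl mul_scalar_mx.
Qed.

Lemma nc_dual (l : C) : nc (l^*)^-1 = (nc l)^-1.
Proof. by rewrite ncV ncJ. Qed.

(** [v] and a dual eigenvector [w] are null, their eigenvalues being off the unit circle. If
    orthogonal they would be proportional, so [l] would equal its inverse conjugate and have modulus
    1. The end whose eigenvalue exceeds 1 in modulus is listed first. *)
Lemma lox_axis_of_eigen (A : mx) (v : vec) l : in_U A -> v != 0 ->
  A *m v = l *: v -> nc l != 1 -> exists a b m, lox_axis A a b m.
Proof.
move=> hA v0 hv hl; have l0 := eigen_neq0 hA v0 hv.
have nl0 : 0 < nc l by rewrite nc_gt0.
have [w w0 hw] := dual_eigenvector hA v0 hv.
have hlw : nc (l^*)^-1 != 1 by rewrite nc_dual invr_eq1.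
have qv := eigen_mod_null hA hv hl; have qw := eigen_mod_null hA hw hlw.
have bv : on_bd v by apply/on_bdP. have bw : on_bd w by apply/on_bdP.
have hvw : hform v w != 0.
  apply/eqP => h; have [|c c0 hc] := closure_orth_null bw v0 _ h; first by rewrite qv.
  have : l *: v = (l^*)^-1 *: v.
    by rewrite -hv hc -scalemxAr hw !scalerA mulrC.
  move=> /eqP; rewrite -subr_eq0 -scalerBl scaler_eq0 (negPf v0) orbF subr_eq0.
  move=> /eqP hE; have := nc_dual l; rewrite -hE => hE2.
  have : nc l * nc l = 1 by rewrite {2}hE2 mulfV // lt0r_neq0.
  by move=> hsq; move/eqP: hl; apply; nra.
have [h1|h1|/eqP h1] := ltgtP 1 (nc l).
- by exists v, w, l.
- exists w, v, (l^*)^-1; split=> //; first exact: hform_neq0C.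
    by rewrite nc_dual invf_gt1.
  by rewrite dualK.
- by rewrite eq_sym (negPf hl) in h1.
Qed.

(** A closed-ball vector orthogonal to [a] or [b] is a multiple of it. An eigenvector pairing with
    both would have an eigenvalue dual to both of theirs, giving [|l| = 1/|l|]. *)
Lemma axis_fixcl (A : mx) (a b z : vec) l : in_U A -> lox_axis A a b l ->
  z != 0 -> qf z <= 0 -> fixes A z ->
  (exists2 c, c != 0 & z = c *: a) \/ (exists2 c, c != 0 & z = c *: b).
Proof.
move=> hA [ba bb hab hl [ha hb]] z0 qz [m hz].
have [/eqP h|hza] := boolP (hform z a == 0); first by left; apply: closure_orth_null.
have [/eqP h|hzb] := boolP (hform z b == 0); first by right; apply: closure_orth_null.
have h1 := eigen_pair hA hz ha hza; have h2 := eigen_pair hA hz hb hzb.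
have m0 : m != 0 by apply/eqP => m0; move: h1; rewrite m0 mul0r => /eqP; rewrite eq_sym oner_eq0.
have : l^* = ((l^*)^-1)^* by apply: (mulfI m0); rewrite h1 h2.
rewrite conjV conjCK => h3.
have : nc l = (nc l)^-1 by rewrite -ncV -h3 ncJ.
have n0 : 0 < nc l by apply: lt_trans hl.
move=> h4; have : nc l * nc l = 1 by rewrite {2}h4 mulfV // lt0r_neq0.
by move=> h5; exfalso; move: hl h5; nra.
Qed.

Lemma prop_orth (a b : vec) c : on_bd a -> a = c *: b -> hform a b = 0.
Proof.
move=> [a0 qa] h; have c0 : c != 0 by apply: contra a0 => /eqP c0; rewrite h c0 scale0r.
have c1 : c^* != 0 by rewrite conjC_eq0.
by apply: (mulfI c1); rewrite -hformZr -h mulr0.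
Qed.

Lemma axis_loxodromic (A : mx) (a b : vec) l : in_U A -> lox_axis A a b l ->
  loxodromic A.
Proof.
move=> hA hx; have [ba bb hab hl [ha hb]] := hx; split.
  move=> [c [hc hE]].
  have hla : l *: a = c *: a by rewrite -ha hE -scalemxAl mul1mx.
  have [a0 _] := ba.
  move/eqP: hla; rewrite -subr_eq0 -scalerBl scaler_eq0 (negPf a0) orbF subr_eq0.
  move=> /eqP hlc; move: hl; rewrite hlc.
  by have /eqP := hc; rewrite nc_unit => /eqP ->; rewrite ltxx.
have [[a0 qa] [b0 qb]] := (ba, bb).
exists [:: a; b]; split=> //; split; last split.
- move=> z; rewrite !inE => /orP[] /eqP ->; split=> //; split.
  + by split=> //; rewrite qa.
  + by exists l.
  + by split=> //; rewrite qb.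
  + by exists (l^*)^-1.
- move=> [|[|i]] [|[|j]] //= _ _ _ [c [c0 hc]].
    by move/eqP: hab; apply; apply: prop_orth hc.
  by move/eqP: (hform_neq0C hab); apply; apply: prop_orth hc.
- move=> z [[z0 qz] hf]; rewrite hform_le0 in qz.
  have [[c c0 hc]|[c c0 hc]] := axis_fixcl hA hx z0 qz hf.
    by exists a; [rewrite inE eqxx | exists c].
  by exists b; [rewrite !inE eqxx orbT | exists c].
Qed.

Lemma hform_comb (a b : vec) t : qf a = 0 -> qf b = 0 ->
  qf (a + t *: b) = 2 * complex.Re (t^* * hform a b).
Proof.
move=> qa qb; apply: (@complexI R).
rewrite -hform_qf !(hformDl, hformDr, hformZl, hformZr) !hform_qf qa qb.
rewrite (hformC a b).
have -> : t * (hform a b)^* = (t^* * hform a b)^* by rewrite conjM conjCK.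
have reJ (w : C) : w + w^* = real_complex R (2 * complex.Re w).
  by rewrite [RHS]rcM (rmorph_nat (real_complex R) 2); exact: addcJ.
rewrite -reJ -[real_complex R 0]/(0 : C); ring.
Qed.

(** The coefficient of [b] is chosen to turn the cross terms into [-2 |<a,b>|^2]. *)
Lemma negative_comb (a b : vec) : qf a = 0 -> qf b = 0 -> hform a b != 0 ->
  qf (a + (- hform a b) *: b) < 0.
Proof.
move=> qa qb h; rewrite hform_comb //.
have -> : (- hform a b)^* * hform a b = - real_complex R (nc (hform a b) ^+ 2).
  by rewrite nc_sq rmorphN /=; ring.
by rewrite /= mulrN oppr_lt0 mulr_gt0 // exprn_gt0 // nc_gt0.
Qed.

Lemma same_eigen_negative (A : mx) (a b : vec) l : on_bd a -> on_bd b ->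
  hform a b != 0 -> A *m a = l *: a -> A *m b = l *: b ->
  exists z, in_H z /\ A *m z = l *: z.
Proof.
move=> /on_bdP [a0 qa] /on_bdP [b0 qb] h ha hb.
exists (a + (- hform a b) *: b); split; first by rewrite /in_H hform_lt0 negative_comb.
by rewrite mulmxDr -scalemxAr ha hb scalerDr !scalerA mulrC.
Qed.

Lemma unit_dual (l m : C) : nc l = 1 -> m * l^* = 1 -> m = l.
Proof.
move=> hl h; have l0 : l != 0 by rewrite -nc_gt0 hl.
have l1 : l^* != 0 by rewrite conjC_eq0.
by apply: (mulIf l1); rewrite h -nc_sq hl expr1n.
Qed.

(** The eigenvalue at [b] is dual to [l], and a number of modulus 1 is its own dual; so [A] is
    scalar on the span of [a] and [b], which contains negative vectors. *)
Lemma unit_eigen_negative (A : mx) (a b : vec) l m : in_U A -> on_bd a -> on_bd b ->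
  hform a b != 0 -> A *m a = l *: a -> A *m b = m *: b -> nc l = 1 ->
  exists z, in_H z /\ A *m z = l *: z.
Proof.
move=> hA ba bb h ha hb hl; apply: (same_eigen_negative ba bb h ha).
by rewrite hb (unit_dual hl (eigen_pair hA hb ha (hform_neq0C h))).
Qed.

(** The eigenvalue at [c] is dual to both [l] and [m], so these agree; they are also dual to each
    other, which gives modulus 1. *)
Lemma three_fixed_scalar (A : mx) (a b c : vec) l m : in_U A ->
  hform a b != 0 -> hform c a != 0 -> hform c b != 0 ->
  A *m a = l *: a -> A *m b = m *: b -> fixes A c -> nc l = 1 /\ m = l.
Proof.
move=> hA hab hca hcb ha hb [p hc].
have h1 := eigen_pair hA hc ha hca; have h2 := eigen_pair hA hc hb hcb.
have h3 := eigen_pair hA ha hb hab.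
have p0 : p != 0.
  by apply/eqP => p0; move: h1; rewrite p0 mul0r => /eqP; rewrite eq_sym oner_eq0.
have hlm : l^* = m^* by apply: (mulfI p0); rewrite h1 h2.
split; last by rewrite -[l]conjCK hlm conjCK.
have := nc_sq l; rewrite hlm h3 => /complexI /eqP.
by rewrite sqrp_eq1 ?nc_ge0 // => /eqP.
Qed.

End LoxodromicAxes.

(** * Invariant subspaces generated by one vector *)

Section StableHull.
Variables (F : fieldType) (m : nat).

Fixpoint word (A B : 'M[F]_m) (w : seq bool) : 'M[F]_m :=
  if w is b :: w' then (if b then A else B) *m word A B w' else 1%:M.

(** [V j] is spanned by the images of [v] under words of length at most [j]. This chain is
    stationary from some [j <= m] on, so a linear condition on short words holds on a whole
    invariant subspace. *)
Lemma stable_hull (A B : 'M[F]_m) (v : 'rV[F]_m) : exists V : 'M[F]_m,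
  [/\ (v <= V)%MS, (V *m A <= V)%MS, (V *m B <= V)%MS &
      forall p (X : 'M[F]_(m, p)),
        (forall w, (size w <= m)%N -> v *m word A B w *m X = 0) -> V *m X = 0].
Proof.
pose step (V : 'M[F]_m) := (V + V *m A + V *m B)%MS.
pose V j := iter j step (<<v>>%MS : 'M[F]_m).
have hv j : (v <= V j)%MS.
  elim: j => [|j IH]; first by rewrite /V /= genmxE.
  by apply: (submx_trans IH); rewrite /V /= /step -addsmxA addsmxSl.
have hkill j p (X : 'M[F]_(m, p)) :
    (forall w, (size w <= m)%N -> v *m word A B w *m X = 0) ->
    forall w, (size w + j <= m)%N -> (V j <= kermx (word A B w *m X))%MS.
  move=> hX; elim: j => [|j IH] w hw.
    rewrite /V /= genmxE; apply/sub_kermxP; rewrite mulmxA.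
    by apply: hX; rewrite addn0 in hw.
  rewrite /V /= -/(V j) /step !addsmx_sub -andbA; apply/and3P; split.
  - by apply: IH; apply: leq_trans hw; rewrite leq_add2l.
  - apply/sub_kermxP; rewrite -mulmxA; have := IH (true :: w).
    by rewrite /= addSn -addnS => /(_ hw) /sub_kermxP; rewrite -(mulmxA A).
  - apply/sub_kermxP; rewrite -mulmxA; have := IH (false :: w).
    by rewrite /= addSn -addnS => /(_ hw) /sub_kermxP; rewrite -(mulmxA B).
have [j hj hst] : exists2 j, (j <= m)%N & (V j.+1 <= V j)%MS.
  (* Otherwise the rank would increase [m + 1] times inside a space of dimension [m]. *)
  apply: contrapT => hno.
  have hrk j : (j <= m.+1)%N -> (j <= \rank (V j))%N.
    elim: j => [//|j IH] hj; apply: (leq_ltn_trans (IH (ltnW hj))).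
    apply: rank_ltmx; rewrite /ltmx; apply/andP; split.
      by rewrite /V /= /step -addsmxA addsmxSl.
    by apply/negP => hle; apply: hno; exists j.
  by have := leq_trans (hrk m.+1 (leqnn _)) (rank_leq_col _); rewrite ltnn.
move: hst; rewrite /V /= -/(V j) /step !addsmx_sub -andbA => /and3P[_ hA hB].
exists (V j); split=> // p X hX.
have := hkill j p X hX [::]; rewrite /= add0n => /(_ hj) /sub_kermxP.
by rewrite mul1mx.
Qed.

(** On the invariant hull of [v], of dimension [r], the restrictions satisfy [B A = c A B].
    Comparing their nonzero determinants gives [c^r = 1]. *)
Lemma scalar_commutator_root (A B : 'M[F]_m) (v : 'rV[F]_m) c :
  A \in unitmx -> B \in unitmx -> v != 0 ->
  (forall w, (size w <= m)%N ->
     v *m word A B w *m (B *m A) = c *: (v *m word A B w *m (A *m B))) ->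
  exists d, [/\ (0 < d)%N, (d <= m)%N & c ^+ d = 1].
Proof.
move=> hA hB v0 hw; have [V [hv hVA hVB hV]] := stable_hull A B v.
have {}hV : V *m (B *m A) = c *: (V *m (A *m B)).
  apply/eqP; rewrite -subr_eq0 scalemxAr -mulmxBr; apply/eqP/hV => w /hw h.
  by rewrite mulmxBr h scalemxAr subrr.
set r := \rank V.
have [W [hWf hWV]] : exists W : 'M[F]_(r, m), row_free W /\ (W :=: V)%MS.
  by exists (row_base V); split; [exact: row_base_free | exact: eq_row_base].
have hWA : (W *m A <= W)%MS.
  by rewrite (eqmxMr _ hWV) hWV.
have hWB : (W *m B <= W)%MS.
  by rewrite (eqmxMr _ hWV) hWV.
have [A1 hA1] := submxP hWA; have [B1 hB1] := submxP hWB.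
have hcomm : B1 *m A1 = c *: (A1 *m B1).
  apply: (row_free_inj hWf); rewrite /= -scalemxAl -!mulmxA. rewrite -hA1 -hB1 !mulmxA -hA1 -hB1.
  have [Y hY] : exists Y, W = Y *m V.
    by apply/submxP; rewrite hWV.
  by rewrite -!mulmxA !(mulmxA W) hY -!mulmxA hV -scalemxAr.
(* A row killed by the restriction [Z1] would be killed by the invertible [Z]. *)
have hdet (Z : 'M_m) (Z1 : 'M_r) : Z \in unitmx -> W *m Z = Z1 *m W -> \det Z1 != 0.
  move=> hZ hE; apply/negP => /det0P [u u0 hu]; move/negP: u0; apply.
  apply/eqP; apply: (row_free_inj hWf); rewrite mul0mx.
  rewrite -[LHS]mulmx1 -(mulmxV hZ) mulmxA -(mulmxA u) hE.
  by rewrite (mulmxA u) hu !mul0mx.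
have r0 : (0 < r)%N.
  rewrite lt0n mxrank_eq0; apply: contra v0 => /eqP V0.
  by move: hv; rewrite V0 submx0.
exists r; split=> //; first exact: rank_leq_col.
have := congr1 determinant hcomm; rewrite detZ !det_mulmx [\det B1 * _]mulrC => h.
have h0 : \det A1 * \det B1 != 0 by apply: mulf_neq0; [apply: (hdet A) | apply: (hdet B)].
by apply: (mulIf h0); rewrite -h mul1r.
Qed.

Lemma iter_mulmxS (T : 'M[F]_m) k :
  iter k.+1 (mulmx T) 1%:M = iter k (mulmx T) 1%:M *m T.
Proof.
elim: k => [|k IH]; first by rewrite /= mulmx1 mul1mx.
by rewrite iterS {1}IH iterS mulmxA.
Qed.

(** Case of two equal generators, where a word depends only on its length; this is linear recurrence
    for powers. *)
Lemma power_orbit_kernel (T : 'M[F]_m) (v : 'rV[F]_m) p (X : 'M[F]_(m, p)) :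
  (forall k, (k <= m)%N -> v *m iter k (mulmx T) 1%:M *m X = 0) ->
  forall k, v *m iter k (mulmx T) 1%:M *m X = 0.
Proof.
have hword w : word T T w = iter (size w) (mulmx T) 1%:M.
  by elim: w => [//|b w IH] /=; rewrite IH; case: b.
move=> h; have [V [hv hVT _ hV]] := stable_hull T T v.
have {}hV : V *m X = 0 by apply: hV => w hw; rewrite hword; apply: h.
have hk k : (v *m iter k (mulmx T) 1%:M <= V)%MS.
  elim: k => [|k IH]; first by rewrite mulmx1.
  by rewrite iter_mulmxS mulmxA; apply: (submx_trans _ hVT); apply: submxMr.
by move=> k; have /submxP [Y ->] := hk k; rewrite -mulmxA hV mulmx0.
Qed.

End StableHull.

(** [h] is an orbit of a linear endomorphism of the space of matrices, of dimension [N * N]; so a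
    linear condition on its terms up to [N * N] propagates to all of them. *)
Lemma conjugation_orbit_kernel (F : fieldType) (N p q : nat) (f f' g : 'M[F]_N)
  (phi : {linear 'M[F]_N -> 'M[F]_(p, q)}) (h : nat -> 'M[F]_N) :
  h 0%N = g -> (forall k, h k.+1 = f *m h k *m f') ->
  (forall k, (k <= N * N)%N -> phi (h k) = 0) -> forall k, phi (h k) = 0.
Proof.
move=> h0 hS hphi.
pose T := lin_mx (mulmxr f' \o mulmx f).
have hk k : mxvec (h k) = mxvec g *m iter k (mulmx T) 1%:M.
  elim: k => [|k IH]; first by rewrite h0 mulmx1.
  by rewrite iter_mulmxS mulmxA -IH mul_vec_lin hS.
have hp k : mxvec (phi (h k)) = mxvec g *m iter k (mulmx T) 1%:M *m lin_mx phi.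
  by rewrite -hk mul_vec_lin.
move=> k; apply: (can_inj mxvecK); rewrite hp linear0.
by apply: power_orbit_kernel => j hj; rewrite -hp hphi // linear0.
Qed.

(** * Growth of orbits along a loxodromic axis *)

Section AxisDynamics.
Variables (R : realType) (n : nat).
Local Notation C := (R[i]).
Local Notation nc := (@Normc.normc R).
Local Notation mx := ('M[C]_(n.+1)).
Local Notation vec := ('cV[C]_(n.+1)).
Local Notation cJ := (@cJ R n).

Lemma mn_vec_le (u : vec) (e : R) : (forall i, nc (u i 0) <= e) -> mn u <= n.+1%:R * e.
Proof.
move=> h; have := @mn_le _ _ _ u e; rewrite muln1; apply=> i j.
by rewrite (ord1 j).
Qed.

(** Properness of the action. Each basis vector splits as a multiple of [z] plus some [u j]
    orthogonal to [z]; the image of [u j] is orthogonal to the negative vector [A z] and keeps its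
    [qf], so [orth_neg_bound] controls it. *)
Lemma U_bounded_of_negative (z : vec) (M : R) : qf z < 0 ->
  exists M', forall A : mx, in_U A -> mn (A *m z) <= M -> mn A <= M'.
Proof.
move=> hz; set s := Num.sqrt (- qf z).
have s0 : 0 < s by rewrite sqrtr_gt0 oppr_gt0.
pose al (j : 'I_n.+1) : C := hform (delta_mx j 0 : vec) z / hform z z.
pose u (j : 'I_n.+1) : vec := delta_mx j 0 - al j *: z.
have hzz : hform z z != 0 by rewrite hform_eq0 lt_eqF.
have hu j : hform (u j) z = 0.
  by rewrite /u hformDl hformNl hformZl /al mulfVK // subrr.
pose B j := nc (al j) * `|M| + Num.sqrt (qf (u j)) * (1 + `|M| / s).
have B0 j : 0 <= B j.
  rewrite addr_ge0 ?mulr_ge0 ?nc_ge0 ?sqrtr_ge0 // addr_ge0 //.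
  by rewrite divr_ge0 // ltW.
exists ((n.+1 * n.+1)%:R * \sum_j B j) => A hA hM; apply: mn_le => i j.
have hM' : mn (A *m z) <= `|M| by apply: (le_trans hM); rewrite ler_norm.
apply: (@le_trans _ _ (B j)); last first.
  by rewrite (bigD1 j) //= lerDl sumr_ge0.
have -> : A i j = al j * (A *m z) i 0 + (A *m u j) i 0.
  have -> : A i j = (A *m (delta_mx j 0 : vec)) i 0 by rewrite -colE [RHS]mxE.
  have {1}-> : (delta_mx j 0 : vec) = al j *: z + u j by rewrite /u addrC subrK.
  by rewrite mulmxDr -scalemxAr !mxE.
apply: (le_trans (ncD _ _)); rewrite ncM; apply: lerD.
  by rewrite ler_wpM2l ?nc_ge0 // (le_trans (mn_entry _ _ _)).
have hAz : qf (A *m z) < 0 by rewrite qfU.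
have hAu : hform (A *m u j) (A *m z) = 0 by rewrite hformU.
apply: (le_trans (orth_neg_bound hAz hAu i)); rewrite !qfU //.
rewrite ler_wpM2l ?sqrtr_ge0 // lerD2l ler_wpM2r // invr_ge0 ltW //.
Qed.

(** Such a [u] is orthogonal to a negative vector in the span of [a] and [b]. *)
Lemma perp_bound (a b : vec) : qf a = 0 -> qf b = 0 -> hform a b != 0 ->
  exists K, forall u, hform u a = 0 -> hform u b = 0 -> mn u <= K * Num.sqrt (qf u).
Proof.
move=> qa qb hab; have hz := negative_comb qa qb hab.
set z := a + _ in hz.
exists (n.+1%:R * (1 + mn z / Num.sqrt (- qf z))) => u ua ub.
have huz : hform u z = 0 by rewrite hformDr hformZr ua ub mulr0 addr0.
by rewrite -mulrA; apply: mn_vec_le => i; rewrite [leRHS]mulrC orth_neg_bound.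
Qed.

Lemma lox_axis_inv (f : mx) (a b : vec) l : in_U f -> lox_axis f a b l ->
  lox_axis (invmx f) b a (l^*).
Proof.
move=> hf [ba bb hab hl [ha hb]]; split=> //; first exact: hform_neq0C.
  by rewrite ncJ.
by rewrite (eigenV hf ha) (eigenV hf hb) invrK conjCK.
Qed.

Lemma lox_axisX (f : mx) (a b : vec) l d : (0 < d)%N -> lox_axis f a b l ->
  lox_axis (f ^+ d) a b (l ^+ d).
Proof.
move=> d0 [ba bb hab hl [ha hb]]; split=> //.
  by rewrite ncX exprn_egt1 // -lt0n.
split; first exact: eigenX.
by rewrite (eigenX _ hb) rmorphXn exprVn.
Qed.

(** Here [y = p a + u] with [u] orthogonal to [a] and [b]. The inverse powers contract [a], and
    preserve both [qf u] and the orthogonality, so [perp_bound] applies. *)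
Lemma contracted_orbit_bounded (f : mx) (a b y : vec) l : in_U f ->
  lox_axis f a b l -> hform y a = 0 ->
  exists M, forall k, mn (invmx f ^+ k *m y) <= M.
Proof.
move=> hf [/on_bdP[a0 qa] /on_bdP[b0 qb] hab hl [ha hb]] hya.
have [K hK] := perp_bound qa qb hab.
pose p := hform y b / hform a b; pose u := y - p *: a.
have hua : hform u a = 0 by rewrite hformDl hformNl hformZl hya hform_qf qa mulr0 subr0.
have hub : hform u b = 0 by rewrite hformDl hformNl hformZl /p mulfVK // subrr.
exists (nc p * mn a + K * Num.sqrt (qf u)) => k.
have -> : y = p *: a + u by rewrite addrC subrK.
have hfk := in_UX k (in_UV hf).
have hka := eigenX k (eigenV hf ha); have hkb := eigenX k (eigenV hf hb).
have l0 : 0 < nc l by apply: lt_trans hl.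
rewrite mulmxDr -scalemxAr hka.
apply: (le_trans (mnD _ _)); apply: lerD.
  rewrite !mnZ ler_wpM2l ?nc_ge0 // ler_piMl ?mn_ge0 // ncX ncV.
  by rewrite exprn_ile1 ?invr_ge0 ?(ltW l0) // invf_le1 // ltW.
have perp (e : vec) m : invmx f ^+ k *m e = m *: e -> m != 0 -> hform u e = 0 ->
    hform (invmx f ^+ k *m u) e = 0.
  move=> he m0 hue; have m1 : m^* != 0 by rewrite conjC_eq0.
  by apply: (mulfI m1); rewrite -hformZr -he hformU // hue mulr0.
have lk : l != 0 by rewrite -nc_gt0.
rewrite -(qfU u hfk); apply: hK.
  by apply: perp hka _ hua; rewrite expf_neq0 // invr_eq0.
by apply: perp hkb _ hub; rewrite expf_neq0 // invrK conjC_eq0.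
Qed.

(** The [b]-component is stretched by exactly [|l|^k]; what remains is orthogonal to [a] and has a
    bounded orbit. *)
Lemma orbit_growth (f : mx) (a b x : vec) l : in_U f -> lox_axis f a b l ->
  exists M, forall k, mn (invmx f ^+ k *m x) <= M * nc l ^+ k.
Proof.
move=> hf hax; have [/on_bdP[a0 qa] bb hab hl [ha hb]] := hax.
have hba := hform_neq0C hab.
pose r := hform x a / hform b a; pose y := x - r *: b.
have hy : hform y a = 0 by rewrite hformDl hformNl hformZl /r mulfVK // subrr.
have [M hM] := contracted_orbit_bounded hf hax hy.
exists (nc r * mn b + `|M|) => k.
have -> : x = r *: b + y by rewrite addrC subrK.
rewrite mulmxDr -scalemxAr (eigenX k (eigenV hf hb)).
apply: (le_trans (mnD _ _)); rewrite mulrDl; apply: lerD.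
  by rewrite !mnZ ncX invrK ncJ -mulrA [mn b * _]mulrC.
apply: (le_trans (hM k)); apply: (le_trans (ler_norm _)).
by rewrite ler_peMr // exprn_ege1 // ltW.
Qed.

Lemma expr_unbounded (L M y : R) : 1 < L -> 0 <= y -> (forall k, y * L ^+ k <= M) -> y = 0.
Proof.
move=> hL y0 h; apply/eqP; rewrite eq_le y0 andbT leNgt; apply/negP => hy.
have bern k : 1 + k%:R * (L - 1) <= L ^+ k.
  elim: k => [|k IH]; first by rewrite mul0r addr0 expr0.
  rewrite exprSr -natr1; have k0 : 0 <= k%:R :> R by [].
  have : (1 + k%:R * (L - 1)) * L <= L ^+ k * L by rewrite ler_wpM2r //; lra.
  by apply: le_trans; have := mulr_ge0 k0 (sqr_ge0 (L - 1)); rewrite expr2; nra.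
have hc : 0 < y * (L - 1) by rewrite mulr_gt0 // subr_gt0.
have := archi_boundP (x := `|M| / (y * (L - 1))) (divr_ge0 (normr_ge0 _) (ltW hc)).
set k := Num.bound _; rewrite ltr_pdivrMr // => hk.
have := h k; have := bern k; have := ler_norm M => h1 h2 h3.
have : y * (1 + k%:R * (L - 1)) <= y * L ^+ k by rewrite ler_wpM2l.
move: hk; rewrite mulrCA => hk; rewrite mulrDr mulr1; lra.
Qed.

(** Pairing the relation with [b] gives [<g f^k g a, b> = l^(2k) <g f^-k g a, b>]. The left side is
    [O(|l|^k)]. With [g a = r b + y] and [y] orthogonal to [a], the right side is [r <g b, b>] times
    a factor of modulus [|l|^(3k)], up to [O(|l|^(2k))]. Hence [r <g b, b> = 0]. *)
Lemma commuting_conjugates_fix (f g : mx) (a b : vec) l :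
  in_U f -> in_U g -> lox_axis f a b l ->
  (forall k, g *m (f ^+ k *m g *m invmx f ^+ k) *m a
           = f ^+ k *m g *m invmx f ^+ k *m g *m a) ->
  hform (g *m a) a = 0 \/ hform (g *m b) b = 0.
Proof.
move=> hf hg hax hcomm; have [/on_bdP[a0 qa] bb hab hl [ha hb]] := hax.
have hba := hform_neq0C hab; have hfu := U_unit hf.
have l0 : l != 0 by rewrite -nc_gt0; apply: lt_trans hl.
have hrel k : hform (g *m (f ^+ k *m (g *m a))) b
    = l ^+ (2 * k) * hform (g *m (invmx f ^+ k *m (g *m a))) b.
  have := hcomm k; move/(congr1 (fun v => hform v b)).
  rewrite -!mulmxA (eigenX k (eigenV hf ha)) -!scalemxAr hformZl => h1.
  have hVk : invmx f ^+ k *m f ^+ k = 1%:M.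
    elim: k {h1} => [|k IH]; first by rewrite !expr0 mulmx1.
    by rewrite exprSr exprS -mulmxA (mulmxA (invmx f)) mulVmx // mul1mx IH.
  have h2 v : hform (f ^+ k *m v) b = l ^+ k * hform v b.
    rewrite -(hformU _ _ (in_UX k (in_UV hf))) mulmxA hVk mul1mx.
    by rewrite (eigenX k (eigenV hf hb)) hformZr invrK -rmorphXn conjCK.
  have h3 := h2 (g *m (invmx f ^+ k *m (g *m a))).
  have hcancel (X Y : C) : l^-1 ^+ k * X = l ^+ k * Y -> X = l ^+ (2 * k) * Y.
    move=> hXY; rewrite mul2n -addnn exprD -mulrA -hXY mulrA -exprMn mulfV //.
    by rewrite expr1n mul1r.
  by apply: hcancel; apply: etrans h1 h3.
pose r := hform (g *m a) a / hform b a; pose y := g *m a - r *: b.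
have hy : hform y a = 0 by rewrite hformDl hformNl hformZl /r mulfVK // subrr.
have [M1 hM1] := contracted_orbit_bounded hf hax hy.
have [M2] := orbit_growth (g *m a) (in_UV hf) (lox_axis_inv hf hax).
rewrite invmxK ncJ => hM2.
suff : nc (r * hform (g *m b) b) = 0.
  move/eqP; rewrite nc_eq0 !mulf_eq0 invr_eq0 (negPf hba) orbF.
  by case/orP=> /eqP; [left | right].
set L := nc l; have L1 : 1 < L by [].
have c0 : 0 <= cJ by exact: mn_ge0.
pose A1 := cJ * (mn g * M1) * mn b; pose A2 := cJ * (mn g * `|M2|) * mn b.
have bnd (v : vec) m : mn v <= m -> nc (hform (g *m v) b) <= cJ * (mn g * m) * mn b.
  move=> hv; apply: (le_trans (nc_hform _ _)); rewrite ler_wpM2r ?mn_ge0 //.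
  rewrite ler_wpM2l //; apply: (le_trans (mnM _ _)).
  by rewrite ler_wpM2l ?mn_ge0.
apply: (expr_unbounded (L := L) (M := A1 + A2)) => // [|k]; first exact: nc_ge0.
have Lk : 1 <= L ^+ k by rewrite exprn_ege1 // ltW.
have hE : l ^+ (2 * k) * (r * hform (g *m b) b * (l^*) ^+ k)
    = hform (g *m (f ^+ k *m (g *m a))) b - l ^+ (2 * k) * hform (g *m (invmx f ^+ k *m y)) b.
  rewrite hrel -mulrBr; congr (_ * _).
  have {1}-> : g *m a = r *: b + y by rewrite addrC subrK.
  rewrite !mulmxDr -!scalemxAr (eigenX k (eigenV hf hb)) -!scalemxAr.
  by rewrite hformDl !hformZl addrK invrK mulrAC mulrA.
have : L ^+ (2 * k) * (nc (r * hform (g *m b) b) * L ^+ k) <= L ^+ (2 * k) * (A1 + A2).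
  have -> : L ^+ (2 * k) * (nc (r * hform (g *m b) b) * L ^+ k)
      = nc (l ^+ (2 * k) * (r * hform (g *m b) b * l^* ^+ k)).
    by rewrite [RHS]ncM [in RHS](ncM _ (l^* ^+ k)) !ncX ncJ.
  rewrite hE; apply: (le_trans (ncD _ _)); rewrite ncN addrC mulrDr; apply: lerD.
    rewrite ncM ncX -/L ler_wpM2l ?exprn_ge0 // ?(le_trans _ (ltW L1)) //.
    exact: bnd (hM1 k).
  apply: (le_trans (bnd _ (`|M2| * L ^+ k) _)).
    by apply: (le_trans (hM2 k)); rewrite ler_wpM2r ?ler_norm // (le_trans _ Lk).
  rewrite /A2 mul2n -addnn exprD.
  have -> : cJ * (mn g * (`|M2| * L ^+ k)) * mn b = L ^+ k * (cJ * (mn g * `|M2|) * mn b) by ring.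
  rewrite ler_wpM2r ?mulr_ge0 ?mn_ge0 // ler_peMl // (le_trans _ Lk) //.
by rewrite ler_pM2l // exprn_gt0 // (lt_trans _ L1).
Qed.

(** The conjugates [f^-k g f^k] keep the eigenvalue at [a] and have bounded values at [b], so they
    are bounded. By discreteness two agree up to a scalar, so some [f^d] commutes with [g] up to a
    scalar and fixes [g b]. This point is [a] or [b], and [a] is excluded because [g] fixes [a]. *)
Lemma discrete_fix_one_end (S : mx -> Prop) (f g : mx) (a b : vec) l :
  is_PU_subgroup S -> discrete S -> S f -> S g -> lox_axis f a b l ->
  fixes g a -> fixes g b.
Proof.
move=> hS hd hSf hSg hax [p hga]; have hf := sgU hS hSf; have hg := sgU hS hSg.
have [/on_bdP[a0 qa] bb hab hl [ha hb]] := hax; have [b0 qb] := (on_bdP b).1 bb.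
have hfu := U_unit hf; set f' := invmx f.
have hVk k : f' ^+ k *m f ^+ k = 1%:M.
  elim: k => [|k IH]; first by rewrite !expr0 mulmx1.
  by rewrite exprSr exprS -mulmxA (mulmxA f') mulVmx // mul1mx IH.
have l0 : l != 0 by rewrite -nc_gt0; apply: lt_trans hl.
have L0 : 0 < nc l by rewrite nc_gt0.
have hz := negative_comb qa qb hab; set t := - hform a b in hz.
(* The growth [|l|^k] of [f^-k g b] cancels against the contraction of [b] under [f^k]. *)
have [M1 hM1] := orbit_growth (g *m b) hf hax.
pose T k := f' ^+ k *m g *m f ^+ k.
have hT k : mn (T k *m (a + t *: b)) <= nc p * mn a + nc t * M1.
  have hTa : T k *m a = p *: a.
    rewrite /T -!mulmxA (eigenX k ha) -!scalemxAr hga -scalemxAr (eigenX k (eigenV hf ha)).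
    by rewrite !scalerA exprVn mulrAC mulfV ?mul1r // expf_neq0.
  rewrite mulmxDr -scalemxAr hTa; apply: (le_trans (mnD _ _)); rewrite !mnZ lerD2l.
  rewrite ler_wpM2l ?nc_ge0 // /T -!mulmxA (eigenX k hb) -!scalemxAr mnZ ncX nc_dual.
  by rewrite exprVn mulrC ler_pdivrMr ?exprn_gt0.
have [M' hM'] := U_bounded_of_negative (nc p * mn a + nc t * M1) hz.
have hST k : S (T k) by do 2?apply: sgM => //; apply: sgX => //; apply: sgV.
have [i [j [hij [c [hc hE]]]]] : exists i j, (i < j)%N /\ pu_eq (T j) (T i).
  apply: (discrete_bounded_repeats hS hd hST (M := M')) => k.
  by apply: hM'; [exact: (sgU hS (hST k)) | exact: hT].
have d0 : (0 < j - i)%N by rewrite subn_gt0.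
set d := (j - i)%N in d0.
have hVk' k : f ^+ k *m f' ^+ k = 1%:M by apply: mulmx1C.
have hEd : f' ^+ d *m g *m f ^+ d = c *: g.
  have : f ^+ i *m T j *m f' ^+ i = c *: g.
    rewrite hE -scalemxAr -scalemxAl /T !mulmxA hVk' mul1mx -!mulmxA hVk' mulmx1 //.
  have hji : j = (i + d)%N by rewrite subnKC // ltnW.
  rewrite /T hji exprD addnC exprD !mulmxA hVk' mul1mx => <-.
  by rewrite -!mulmxA hVk' mulmx1.
have hgb : fixes (f ^+ d) (g *m b).
  have hbd := eigenX d hb.
  have h1 : g *m (f ^+ d *m b) = c *: (f ^+ d *m (g *m b)).
    rewrite -[g *m _]mul1mx -(hVk' d) -!mulmxA (mulmxA g) (mulmxA _ (g *m _)) (mulmxA (f' ^+ d) g) hEd.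
    by rewrite -!scalemxAl -scalemxAr.
  have c0 : c != 0 by rewrite -normr_gt0 hc.
  exists (c^-1 * (l^*)^-1 ^+ d).
  by rewrite -scalerA [_ *: (g *m b)]scalemxAr -hbd h1 scalerA mulVf // scale1r.
have gb0 : g *m b != 0 by apply: unit_mul_neq0 => //; apply: U_unit.
have qgb : qf (g *m b) <= 0 by rewrite qfU // qb.
have [[s s0 hs]|[s s0 hs]] := axis_fixcl (in_UX d hf) (lox_axisX d0 hax) gb0 qgb hgb.
  move/eqP: (hform_neq0C hab); case; rewrite -(hformU _ _ hg) hs hga.
  by rewrite hformZl hformZr hform_qf qa !mulr0.
by exists s.
Qed.

End AxisDynamics.

(** * Commutators and elements near the identity *)

Section SmallElements.
Variables (R : realType) (n : nat).
Local Notation C := (R[i]).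
Local Notation nc := (@Normc.normc R).
Local Notation mx := ('M[C]_(n.+1)).
Local Notation vec := ('cV[C]_(n.+1)).
Local Notation cJ := (@cJ R n).

(** The commutator in the convention [g h = h g (kappa g h)]. *)
Definition kappa (g h : mx) : mx := invmx g *m invmx h *m g *m h.

Definition near1_bound : R := mn (1%:M : mx) + 1.
Local Notation E := near1_bound.

Lemma near1_bound_ge1 : 1 <= E.
Proof. by rewrite /near1_bound lerDr mn_ge0. Qed.

Lemma mn_near1 (g : mx) : mn (g - 1%:M) <= 1 -> mn g <= E.
Proof.
move=> h; rewrite -[g](subrK 1%:M); apply: (le_trans (mnD _ _)).
by rewrite addrC lerD2l.
Qed.

Lemma mn_inv_near1 (g : mx) : in_U g -> mn (g - 1%:M) <= 1 -> mn (invmx g) <= cJ ^+ 2 * E.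
Proof.
move=> hg h; apply: (le_trans (mn_invmx hg)).
by rewrite ler_wpM2l ?sqr_ge0 // mn_near1.
Qed.

(** The two inverses cost [cJ^2 E] each and the two terms of the commutator a factor 2; adding 1
    makes the constant at least 1. *)
Definition kappa_const : R := 2 * (cJ ^+ 2 * E) ^+ 2 + 1.
Local Notation C0 := kappa_const.

Lemma kappa_const_ge1 : 1 <= C0.
Proof. by rewrite /kappa_const lerDr mulr_ge0 // sqr_ge0. Qed.

(* [g h - h g] is the commutator of [g - 1] and [h - 1], hence quadratically small. *)
Lemma kappa_near1 (g h : mx) : in_U g -> in_U h ->
  mn (g - 1%:M) <= 1 -> mn (h - 1%:M) <= 1 ->
  mn (kappa g h - 1%:M) <= C0 * (mn (g - 1%:M) * mn (h - 1%:M)).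
Proof.
move=> hg hh g1 h1; have hgu := U_unit hg; have hhu := U_unit hh.
set x := g - 1%:M in g1 *; set y := h - 1%:M in h1 *.
have -> : kappa g h - 1%:M = invmx g *m (invmx h *m (x *m y - y *m x)).
  have -> : x *m y - y *m x = g *m h - h *m g.
    rewrite /x /y !(mulmxBl, mulmxBr) !mul1mx !mulmx1.
    by rewrite !opprB !addrA; apply/matrixP => i j; rewrite !mxE; ring.
  rewrite !mulmxBr /kappa -!mulmxA; congr (_ - _).
  by rewrite (mulmxA (invmx h)) mulVmx // mul1mx mulVmx.
have k1 := mn_inv_near1 hg g1; have k2 := mn_inv_near1 hh h1.
set k := cJ ^+ 2 * E in k1 k2.
apply: (le_trans (mnM _ _)).
have h3 : mn (x *m y - y *m x) <= 2 * (mn x * mn y).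
  apply: (le_trans (mnB _ _)).
  have := mnM x y; have := mnM y x; rewrite [mn y * mn x]mulrC; lra.
have h4 : mn (invmx h *m (x *m y - y *m x)) <= k * (2 * (mn x * mn y)).
  by apply: (le_trans (mnM _ _)); apply: ler_pM; rewrite ?mn_ge0.
apply: (@le_trans _ _ (k * (k * (2 * (mn x * mn y))))).
  by apply: ler_pM; rewrite ?mn_ge0.
have xy0 : 0 <= mn x * mn y by rewrite mulr_ge0 ?mn_ge0.
by rewrite /kappa_const -/k mulrDl mul1r expr2; nra.
Qed.

Lemma conj_near1 (s m : mx) : s \in unitmx ->
  mn (invmx s *m m *m s - 1%:M) <= mn (invmx s) * mn s * mn (m - 1%:M).
Proof.
move=> hs; have -> : invmx s *m m *m s - 1%:M = invmx s *m (m - 1%:M) *m s.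
  by rewrite mulmxBr mulmxBl mulmx1 mulVmx.
apply: (le_trans (mnM _ _)); rewrite mulrAC ler_wpM2r ?mn_ge0 //.
exact: mnM.
Qed.

(** If [c] is not 1, its powers below [d] sum to 0, so the numbers [1 - c^j] sum to [d]; but each of
    them has modulus below 1. *)
Lemma root_of_unity_near1 (c : C) d N : (0 < d)%N -> (d <= N)%N -> c ^+ d = 1 ->
  nc c = 1 -> N%:R * nc (c - 1) < 1 -> c = 1.
Proof.
move=> d0 dN hc hc1 hN; apply/eqP; rewrite -subr_eq0; apply/negP => /negP c1.
have hsum : \sum_(j < d) c ^+ j = 0.
  by apply: (mulfI c1); rewrite -subrX1 hc subrr mulr0.
have hj j : nc (c ^+ j - 1) <= j%:R * nc (c - 1).
  elim: j => [|j IH]; first by rewrite expr0 subrr nc0 mul0r.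
  have -> : c ^+ j.+1 - 1 = c * (c ^+ j - 1) + (c - 1) by rewrite exprS; ring.
  apply: (le_trans (ncD _ _)); rewrite ncM hc1 mul1r -natr1 mulrDl mul1r.
  by rewrite lerD2r.
have hd : nc (\sum_(j < d) (1 - c ^+ j)) = d%:R.
  rewrite sumrB hsum subr0 sumr_const card_ord.
  by rewrite -[1 *+ d]/(d%:R) -(rmorph_nat (real_complex R)) ncR ger0_norm.
have : nc (\sum_(j < d) (1 - c ^+ j)) < d%:R.
  apply: (le_lt_trans (nc_sum _ _ _)).
  have -> : d%:R = \sum_(j < d) (1 : R) by rewrite sumr_const card_ord.
  apply: ltr_sum => [|j _].
    by apply/hasP; exists (Ordinal d0); rewrite ?mem_index_enum.
  rewrite ncB; apply: (le_lt_trans (hj j)); apply: (le_lt_trans _ hN).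
  by rewrite ler_wpM2r ?nc_ge0 // ler_nat (leq_trans _ dN) // ltnW.
by rewrite hd ltxx.
Qed.

(** Otherwise the distance to the identity could be halved forever inside [X], producing nontrivial
    elements of [S] arbitrarily near the identity. *)
Lemma near_minimal (S X : mx -> Prop) (d : R) (g0 : mx) :
  is_PU_subgroup S -> discrete S -> (forall g, X g -> S g /\ ~ pu_eq g 1) ->
  X g0 -> mn (g0 - 1%:M) < d ->
  exists g, [/\ X g, mn (g - 1%:M) < d &
    forall g', X g' -> mn (g - 1%:M) / 2 < mn (g' - 1%:M)].
Proof.
move=> hS hd hX hg0 hg0d; apply: contrapT => hno.
have hstep g : X g -> mn (g - 1%:M) < d ->
    exists g', X g' /\ mn (g' - 1%:M) <= mn (g - 1%:M) / 2.
  move=> hg hgd; apply: contrapT => hno'; apply: hno; exists g; split=> // g' hg'.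
  by rewrite ltNge; apply/negP => hle; apply: hno'; exists g'.
have [e [e0 he]] := discrete_near1 hS hd.
have hseq k : exists g, X g /\ mn (g - 1%:M) * 2 ^+ k <= mn (g0 - 1%:M).
  elim: k => [|k [g [hg hgk]]]; first by exists g0; rewrite expr0 mulr1.
  have p1 : 1 <= 2 ^+ k :> R by rewrite exprn_ege1 // ler1n.
  have [|g' [hg' hle]] := hstep g hg.
    apply: (le_lt_trans _ hg0d); apply: (le_trans _ hgk).
    by rewrite ler_peMr ?mn_ge0.
  exists g'; split=> //; apply: (le_trans _ hgk).
  rewrite exprS mulrA ler_wpM2r ?(le_trans _ p1) //; lra.
have d0 : 0 <= d / e.
  by rewrite divr_ge0 ?(ltW e0) // ltW // (le_lt_trans (mn_ge0 _) hg0d).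
have := archi_boundP d0; set k := Num.bound _ => hk.
have [g [hg hgk]] := hseq k; have [hSg hne] := hX g hg; apply/hne/he => //.
have hk2 : k%:R <= 2 ^+ k :> R by rewrite -natrX ler_nat ltnW // ltn_expl.
rewrite ltNge; apply/negP => hle.
have : e * 2 ^+ k <= mn (g - 1%:M) * 2 ^+ k by rewrite ler_wpM2r // exprn_ge0.
move: hk; rewrite ltr_pdivrMr // => hk h1.
have : e * k%:R <= e * 2 ^+ k by rewrite ler_wpM2l // ltW.
by rewrite mulrC => h2; lra.
Qed.

End SmallElements.

(** * A near-minimal element moving the axis *)

Section MinimalElement.
Variables (R : realType) (n : nat).
Local Notation C := (R[i]).
Local Notation nc := (@Normc.normc R).
Local Notation mx := ('M[C]_(n.+1)).
Local Notation vec := ('cV[C]_(n.+1)).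
Local Notation cJ := (@cJ R n).
Local Notation E := (@near1_bound R n).
Local Notation C0 := (@kappa_const R n).
Local Notation N := (n.+1).

Lemma invmxX (f : mx) k : invmx (f ^+ k) = invmx f ^+ k.
Proof. by rewrite -[invmx (f ^+ k)]/((f ^+ k)^-1) -exprVn. Qed.

(** Chosen so that [C0 * small_eps] is 1/2, the factor lost in near-minimality. *)
Definition small_eps : R := (2 * C0)^-1.

(** Bounds the factor by which conjugation by an element within 1 of the identity enlarges the
    distance to the identity. *)
Definition conj_const : R := cJ ^+ 2 * E * E + 1.

(** The same for conjugation by [f^k], for all [k <= N * N] at once. *)
Definition power_const (f : mx) : R :=
  1 + \sum_(k < (N * N).+1) mn (f ^+ k) * mn (invmx (f ^+ k)).

Lemma small_eps_gt0 : 0 < small_eps.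
Proof.
by rewrite invr_gt0 mulr_gt0 // (lt_le_trans _ (kappa_const_ge1 _ _)).
Qed.

Lemma small_eps_le : small_eps <= 1 / 2.
Proof.
rewrite /small_eps invfM mul1r -[leRHS]mulr1 ler_wpM2l ?invr_ge0 //.
by rewrite invf_le1 ?kappa_const_ge1 // (lt_le_trans _ (kappa_const_ge1 _ _)).
Qed.

Lemma conj_const_ge1 : 1 <= conj_const.
Proof.
have E0 : 0 <= E := le_trans ler01 (near1_bound_ge1 R n).
by rewrite /conj_const lerDr mulr_ge0 // mulr_ge0 // sqr_ge0.
Qed.

Lemma power_const_ge1 f : 1 <= power_const f.
Proof. by rewrite /power_const lerDl sumr_ge0 // => k _; rewrite mulr_ge0 ?mn_ge0. Qed.

Lemma power_const_bound f k : (k <= N * N)%N ->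
  mn (f ^+ k) * mn (invmx (f ^+ k)) <= power_const f.
Proof.
move=> hk; rewrite /power_const (bigD1 (Ordinal (hk : k < (N * N).+1)%N)) //=.
rewrite addrCA lerDl addr_ge0 // sumr_ge0 // => i _; by rewrite mulr_ge0 ?mn_ge0.
Qed.

Variables (S : mx -> Prop) (f : mx) (a b : vec) (l : C).
Hypotheses (hS : is_PU_subgroup S) (hd : discrete S) (hSf : S f).
Hypothesis hax : lox_axis f a b l.

Definition fix2 (m : mx) : Prop := fixes m a /\ fixes m b.

Lemma fix2M m p : fix2 m -> fix2 p -> fix2 (m *m p).
Proof. by move=> [h1 h2] [h3 h4]; split; apply: fixM. Qed.

Lemma fix2V m : m \in unitmx -> fix2 m -> fix2 (invmx m).
Proof. by move=> hu [h1 h2]; split; apply: fixV. Qed.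

Lemma fix2_axis k : fix2 (f ^+ k).
Proof. by have [_ _ _ _ [ha hb]] := hax; split; apply: fixX; eexists; [exact: ha | exact: hb]. Qed.

Variable g : mx.
Hypotheses (hSg : S g) (hg2 : ~ fix2 g).
Hypothesis hmin : forall g', S g' -> ~ fix2 g' -> mn (g - 1%:M) / 2 < mn (g' - 1%:M).
Local Notation eta := (mn (g - 1%:M)).
(** The first bound leaves room for conjugating by [f^k] and by [N] letters, and for excluding
    nontrivial roots of unity of order at most [N]. The second keeps [<g a, b>] and [<g b, a>]
    nonzero. *)
Hypothesis heta : eta * (conj_const ^+ N * power_const f * N.+1%:R) < small_eps.
Hypothesis hetab : eta * (cJ * mn a * mn b + 1) < nc (hform a b).

Let hf : in_U f := sgU hS hSf.
Let hg : in_U g := sgU hS hSg.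
Let hgu : g \in unitmx := U_unit hg.
Let Df1 := power_const_ge1 f.
Let D1 := conj_const_ge1.

Let DN1 : 1 <= conj_const ^+ N.
Proof. by rewrite exprn_ege1. Qed.

Let N1 : 1 <= N.+1%:R :> R.
Proof. by rewrite ler1n. Qed.

Let eta0 : 0 <= eta := mn_ge0 _.

Let eta_word : eta * (conj_const ^+ N * power_const f) <= small_eps.
Proof.
apply: (le_trans _ (ltW heta)); rewrite ler_wpM2l // ler_peMr //.
by rewrite mulr_ge0 // (le_trans _ Df1, le_trans _ DN1).
Qed.

Let eta_pow : power_const f * eta <= small_eps.
Proof.
apply: (le_trans _ eta_word); rewrite mulrC ler_wpM2l // ler_peMl //.
by rewrite (le_trans _ Df1).
Qed.

Let eta_eps : eta <= small_eps.
Proof. by apply: (le_trans _ eta_pow); rewrite ler_peMl. Qed.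

Let eta1 : eta <= 1.
Proof. by apply: (le_trans eta_eps); apply: (le_trans small_eps_le); lra. Qed.

(** The commutator lies within [C0 * eta * small_eps = eta / 2] of the identity, which
    near-minimality of [g] allows only for elements fixing both ends. *)
Lemma small_kappa_fix2 h : S h -> mn (h - 1%:M) <= small_eps -> fix2 (kappa g h).
Proof.
move=> hSh hs; apply: contrapT => hno.
have hSk : S (kappa g h) by do !apply: sgM => //; apply: sgV.
have := hmin hSk hno; rewrite ltNge => /negP; apply.
have h1 : mn (h - 1%:M) <= 1.
  by apply: (le_trans hs); apply: (le_trans small_eps_le); lra.
apply: (le_trans (kappa_near1 hg (sgU hS hSh) eta1 h1)).
have c0 : 0 < C0 by rewrite (lt_le_trans _ (kappa_const_ge1 _ _)).
apply: (@le_trans _ _ (C0 * (eta * small_eps))).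
  by rewrite ler_wpM2l ?(ltW c0) // ler_wpM2l.
rewrite /small_eps le_eqVlt; apply/orP; left; apply/eqP.
by have := lt0r_neq0 c0; generalize C0 eta => x y hx; field.
Qed.

(** The inverse of [g^-1 m g] is [kappa g m] times the inverse of [m], and both factors fix the
    ends. *)
Lemma small_conj_fix2 m : S m -> fix2 m -> mn (m - 1%:M) <= small_eps ->
  fix2 (invmx g *m m *m g).
Proof.
move=> hSm hm hs; have hmu := U_unit (sgU hS hSm).
have := fix2M (small_kappa_fix2 hSm hs) (fix2V hmu hm).
have -> : kappa g m *m invmx m = invmx (invmx g *m m *m g).
  have hinv : (invmx g *m m *m g) *m (kappa g m *m invmx m) = 1%:M.
    rewrite /kappa -!mulmxA (mulmxA g (invmx g)) mulmxV // mul1mx.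
    by rewrite (mulmxA m (invmx m)) mulmxV // mul1mx mulmx1 mulVmx.
  by rewrite (invmx_of_mul1 hinv).
move=> h; rewrite -[_ *m g]invmxK; apply: fix2V => //.
by rewrite unitmx_inv !unitmx_mul unitmx_inv hgu hmu.
Qed.

Definition fconj k : mx := f ^+ k *m g *m invmx (f ^+ k).

Let hSfk k : S (f ^+ k).
Proof. exact: sgX. Qed.

Let hfku k : f ^+ k \in unitmx.
Proof. exact: U_unit (sgU hS (hSfk k)). Qed.

Lemma S_fconj k : S (fconj k).
Proof. by do !apply: sgM => //; apply: sgV. Qed.

Lemma fconj_near1 k : (k <= N * N)%N -> mn (fconj k - 1%:M) <= small_eps.
Proof.
move=> hk; apply: (le_trans _ eta_pow).
have -> : fconj k - 1%:M = f ^+ k *m (g - 1%:M) *m invmx (f ^+ k).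
  by rewrite mulmxBr mulmxBl mulmx1 mulmxV.
apply: (le_trans (mnM _ _)); apply: (@le_trans _ _ (mn (f ^+ k) * eta * mn (invmx (f ^+ k)))).
  by rewrite ler_wpM2r ?mn_ge0 // mnM.
by rewrite mulrAC ler_wpM2r // power_const_bound.
Qed.

(** Conjugation by [f^k g f^-k] is conjugation by [g] between two conjugations by powers of [f],
    which preserve [fix2]. *)
Lemma small_conj_fconj_fix2 k m : (k <= N * N)%N -> S m -> fix2 m ->
  mn (m - 1%:M) * power_const f <= small_eps ->
  fix2 (invmx (fconj k) *m m *m fconj k).
Proof.
move=> hk hSm hm hs; set fk := f ^+ k.
have hfu : fk \in unitmx := hfku k.
have -> : invmx (fconj k) = fk *m invmx g *m invmx fk.
  have hinv : fconj k *m (fk *m invmx g *m invmx fk) = 1%:M.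
    rewrite /fconj -/fk -!mulmxA (mulmxA (invmx fk) fk) mulVmx // mul1mx.
    by rewrite (mulmxA g) mulmxV // mul1mx mulmxV.
  by rewrite (invmx_of_mul1 hinv).
have -> : fk *m invmx g *m invmx fk *m m *m fconj k
    = fk *m (invmx g *m (invmx fk *m m *m fk) *m g) *m invmx fk.
  by rewrite /fconj -/fk !mulmxA.
have hfk2 : fix2 fk := fix2_axis k.
apply: fix2M; last exact: fix2V.
apply: fix2M => //; apply: small_conj_fix2.
- have hSk : S fk := hSfk k; apply: sgM => //; apply: sgM => //; exact: sgV.
- by apply: fix2M => //; apply: fix2M => //; apply: fix2V.
- apply: (le_trans (conj_near1 _ hfu)); apply: (le_trans _ hs).
  by rewrite mulrC ler_wpM2l ?mn_ge0 // mulrC power_const_bound.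
Qed.

Section Words.
Variable k : nat.
Hypothesis hk : (k <= N * N)%N.
Local Notation h := (fconj k).

(** Letters multiply on the right, so that the transpose is [word] in the transposes of [g] and [h],
    which acts on row vectors. *)
Fixpoint cword (w : seq bool) : mx :=
  if w is c :: w' then cword w' *m (if c then g else h) else 1%:M.

Let hh : in_U h := sgU hS (S_fconj k).

Lemma S_cword w : S (cword w).
Proof.
elim: w => [|c w IH] /=; first exact: sg1.
by apply: sgM => //; case: c => //; apply: S_fconj.
Qed.

(** Each letter costs at most a factor [conj_const]; the assumed bound leaves room for [N] letters,
    so every intermediate conjugate is still small enough for the two preceding lemmas on
    conjugation. *)
Lemma small_conj_word m w : S m -> fix2 m -> (size w <= N)%N ->
  mn (m - 1%:M) * (conj_const ^+ N * power_const f) <= small_eps ->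
  fix2 (invmx (cword w) *m m *m cword w) /\
  mn (invmx (cword w) *m m *m cword w - 1%:M) <= mn (m - 1%:M) * conj_const ^+ size w.
Proof.
move=> hSm hm hw hs; elim: w hw => [_|c w IH /= hw].
  by rewrite /= invmx1 mul1mx mulmx1 expr0 mulr1.
have [h1 h2] := IH (ltnW hw); set t := invmx (cword w) *m m *m cword w in h1 h2.
have hSw := S_cword w.
have hSt : S t by apply: sgM => //; apply: sgM => //; apply: sgV.
have hcu : cword w \in unitmx := U_unit (sgU hS (S_cword w)).
set s := if c then g else h.
have hSs : S s by rewrite /s; case: (c) => //; apply: S_fconj.
have hs1 : mn (s - 1%:M) <= 1.
  rewrite /s; case: (c) => //; apply: (le_trans (fconj_near1 hk)).
  by apply: (le_trans small_eps_le); lra.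
have hsU := sgU hS hSs; have hsu := U_unit hsU.
have -> : invmx (cword w *m s) *m m *m (cword w *m s) = invmx s *m t *m s.
  have -> : invmx (cword w *m s) = invmx s *m invmx (cword w).
    by apply: invmx_of_mul1; rewrite -!mulmxA (mulmxA s) mulmxV // mul1mx mulmxV.
  by rewrite /t !mulmxA.
have ht : mn (t - 1%:M) * power_const f <= small_eps.
  apply: (le_trans _ hs); rewrite mulrA ler_wpM2r ?(le_trans _ Df1) //.
  apply: (le_trans h2); rewrite ler_wpM2l ?mn_ge0 //.
  by apply: ler_weXn2l => //; apply: ltnW.
have ht' : mn (t - 1%:M) <= small_eps.
  by apply: (le_trans _ ht); rewrite ler_peMr ?mn_ge0.
split.
  by rewrite /s; case: (c); [apply: small_conj_fix2 | apply: small_conj_fconj_fix2].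
apply: (le_trans (conj_near1 _ hsu)); rewrite mulrC exprSr mulrA.
apply: ler_pM; rewrite ?mn_ge0 ?mulr_ge0 ?mn_ge0 //.
apply: (@le_trans _ _ (cJ ^+ 2 * E * E)); last by rewrite /conj_const lerDl.
by apply: ler_pM; rewrite ?mn_ge0 // ?mn_inv_near1 // mn_near1.
Qed.

Let ba : on_bd a. Proof. by case: hax. Qed.
Let bb : on_bd b. Proof. by case: hax. Qed.
Let hab : hform a b != 0. Proof. by case: hax. Qed.

(** By [hetab] the change [<(g - 1) x, y>] is smaller than [|<a,b>|]. The general [x] and [y] cover
    both orders of [a] and [b]. *)
Lemma moved_pairing (x y : vec) : mn x * mn y = mn a * mn b ->
  nc (hform x y) = nc (hform a b) -> hform (g *m x) y != 0.
Proof.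
move=> hxy hxy2; rewrite -nc_gt0.
have -> : hform (g *m x) y = hform x y + hform ((g - 1%:M) *m x) y.
  by rewrite mulmxBl mul1mx hformDl hformNl addrC subrK.
have h1 : nc (hform ((g - 1%:M) *m x) y) <= eta * (cJ * mn a * mn b).
  apply: (le_trans (nc_hform _ _)).
  have -> : eta * (cJ * mn a * mn b) = cJ * (eta * mn x) * mn y.
    by rewrite -[cJ * mn a * _]mulrA -hxy; ring.
  rewrite ler_wpM2r ?mn_ge0 // ler_wpM2l ?mn_ge0 //; exact: mnM.
have h2 := ncD (hform x y + hform ((g - 1%:M) *m x) y) (- hform ((g - 1%:M) *m x) y).
rewrite addrK ncN hxy2 in h2.
have h3 := hetab; rewrite mulrDr mulr1 in h3.
have h4 : eta * (cJ * mn a * mn b) < nc (hform a b).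
  by apply: le_lt_trans h3; rewrite lerDl.
by have := lt_le_trans (le_lt_trans h1 h4) h2; rewrite ltrDr.
Qed.

Lemma moved_pairing_ab : hform (g *m a) b != 0.
Proof. exact: moved_pairing. Qed.

Lemma moved_pairing_ba : hform (g *m b) a != 0.
Proof. by apply: moved_pairing; [exact: mulrC | rewrite hformC ncJ]. Qed.

Lemma moved_null (x : vec) : on_bd x -> ~ fixes g x -> hform (g *m x) x != 0.
Proof.
move=> bx hx; apply/eqP => h; apply: hx.
have [x0 qx] := (on_bdP x).1 bx.
have [||c _ hc] := closure_orth_null bx _ _ h; last by exists c.
  exact: unit_mul_neq0.
by rewrite qfU // qx.
Qed.

(* [g] moves [a] or [b], which yields a third null eigenvector of [m]; pairing eigenvectors
   then forces all the eigenvalues to agree. *)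
Lemma small_fix2_scalar m : S m -> fix2 m ->
  mn (m - 1%:M) * (conj_const ^+ N * power_const f) <= small_eps ->
  exists c, nc c = 1 /\ forall w, (size w <= N)%N ->
    m *m (cword w *m a) = c *: (cword w *m a).
Proof.
move=> hSm hm hs; have hmU := sgU hS hSm.
have hs' : mn (m - 1%:M) <= small_eps.
  apply: (le_trans _ hs); rewrite ler_peMr ?mn_ge0 // mulr_ege1 //.
have [hga hgb] := small_conj_fix2 hSm hm hs'.
have [pa hpa] := fix_conj hgu hga; have [pb hpb] := fix_conj hgu hgb.
have [[ca hca] [cb hcb]] := hm.
have [hc1 hcbE] : nc ca = 1 /\ cb = ca.
  have [hfa|hfa] := pselect (fixes g a).
    have hfb : ~ fixes g b by move=> hfb; apply: hg2.
    apply: (three_fixed_scalar hmU hab moved_pairing_ba (moved_null bb hfb) hca hcb).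
    by exists pb.
  apply: (three_fixed_scalar hmU hab (moved_null ba hfa) moved_pairing_ab hca hcb).
  by exists pa.
exists ca; split=> // w hw.
have [[hwa _] _] := small_conj_word hSm hm hw hs.
have hwU := sgU hS (S_cword w); have hwu := U_unit hwU.
have [cx hcx] := fix_conj hwu hwa; set x := cword w *m a in hcx *.
have [a0 qa] := (on_bdP a).1 ba.
have x0 : x != 0 by apply: unit_mul_neq0.
have qx : qf x <= 0 by rewrite qfU // qa.
rewrite hcx; congr (_ *: _).
(* The null vector [x] pairs with [a], or else is a multiple of [a] and pairs with [b]; either way
   its eigenvalue is dual to [ca], hence equal to it. *)
have [/eqP hxa|hxa] := boolP (hform x a == 0); last first.
  by apply: unit_dual hc1 (eigen_pair hmU hcx hca hxa).
apply: unit_dual hc1 _; rewrite -{1}hcbE; apply: (eigen_pair hmU hcx hcb).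
have [s s0 hsx] := closure_orth_null ba x0 qx hxa.
by rewrite hsx hformZl mulf_neq0.
Qed.

(** [kappa g h] acts as one scalar [c] on the images of [a] under words of length at most [N], so
    [g h = c h g] on them. Determinants make [c] a root of unity of order at most [N], and its
    closeness to 1 makes it 1. *)
Lemma commute_on_axis : g *m h *m a = h *m g *m a.
Proof.
have hhs := fconj_near1 hk; have hhu := U_unit hh.
set m := kappa g h.
have hSh := S_fconj k.
have hSm : S m by do !apply: sgM => //; apply: sgV.
have hm2 : fix2 m by apply: small_kappa_fix2 => //; apply: S_fconj.
have h1 : mn (h - 1%:M) <= 1.
  by apply: (le_trans hhs); apply: (le_trans small_eps_le); lra.
have c0 : 0 < C0 by rewrite (lt_le_trans _ (kappa_const_ge1 _ _)).
(* As [C0 * small_eps] is 1/2, [m] is no farther from the identity than [g], so the bounds on [eta]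
   apply to it. *)
have hms : mn (m - 1%:M) <= eta.
  apply: (le_trans (kappa_near1 hg hh eta1 h1)).
  rewrite mulrCA ler_piMr //; apply: (@le_trans _ _ (C0 * small_eps)).
    by rewrite ler_wpM2l // ltW.
  by rewrite /small_eps invfM mulrCA mulfV ?lt0r_neq0 // mulr1 invf_le1 // ler1n.
have hmw : mn (m - 1%:M) * (conj_const ^+ N * power_const f) <= small_eps.
  apply: (le_trans _ eta_word); rewrite ler_wpM2r // mulr_ge0 //.
    by rewrite (le_trans _ DN1).
  by rewrite (le_trans _ Df1).
have [c [hc1 hc]] := small_fix2_scalar hSm hm2 hmw.
have a0 : a != 0 by case: ba.
have hcm : nc (c - 1) <= eta.
  apply: (le_trans _ hms); rewrite -(ler_pM2r (mn_gt0 a0)).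
  apply: (le_trans _ (mnM _ _)); rewrite mulmxBl mul1mx.
  have := hc [::] isT; rewrite /= mul1mx => ->.
  by rewrite -{3}[a]scale1r -scalerBl mnZ.
have gh_hg : g *m h = h *m g *m m.
  rewrite /m /kappa !mulmxA -(mulmxA h) mulmxV // mulmx1 mulmxV // mul1mx //.
have hcw w : (size w <= N)%N -> g *m h *m (cword w *m a) = c *: (h *m g *m (cword w *m a)).
  by move=> hw; rewrite gh_hg -mulmxA hc // -scalemxAr.
have hword w : (a^T *m word g^T h^T w)^T = cword w *m a.
  have -> : word g^T h^T w = (cword w)^T.
    elim: w => [|e w IH]; first by rewrite /= trmx1.
    by rewrite [RHS]trmx_mul -IH; case: e.
  by rewrite -trmx_mul trmxK.
have [||||d [d0 dN hcd]] := @scalar_commutator_root _ _ g^T h^T a^T c.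
- by rewrite unitmx_tr.
- by rewrite unitmx_tr.
- by rewrite -(inj_eq trmx_inj) trmxK trmx0.
- move=> w hw; apply: trmx_inj; rewrite linearZ /=.
  by rewrite -!trmx_mul !(trmx_mul (a^T *m _)) !trmxK hword hcw.
have hc_1 : c = 1.
  apply: (root_of_unity_near1 d0 dN hcd hc1).
  apply: (@le_lt_trans _ _ (N.+1%:R * eta)).
    by apply: ler_pM; rewrite ?nc_ge0 // ler_nat.
  apply: (@le_lt_trans _ _ (eta * (conj_const ^+ N * power_const f * N.+1%:R))).
    rewrite mulrC ler_wpM2l // ler_peMl // mulr_ege1 //.
  by apply: (lt_le_trans heta); apply: (le_trans small_eps_le); lra.
by have := hcw [::] isT; rewrite /= mul1mx hc_1 scale1r.
Qed.

End Words.

Lemma minimal_element_absurd : False.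
Proof.
(* Commutation with [g] on [a] is a linear condition on [X], so it passes from the conjugates with
   [k <= N * N] to all of them. *)
pose phi (X : mx) : vec := g *m X *m a - X *m g *m a.
have phi_lin : linear phi.
  move=> s X Y; rewrite /phi !(mulmxDr, mulmxDl) -!scalemxAr -!scalemxAl scalerBr.
  by rewrite opprD addrACA.
pose phiM := GRing.isLinear.Build _ _ _ _ phi phi_lin.
pose phiL : {linear mx -> vec} := HB.pack phi phiM.
have hall k : phiL (fconj k) = 0.
  apply: (@conjugation_orbit_kernel _ _ _ _ f (invmx f) g phiL fconj).
  - by rewrite /fconj expr0 invmx1 mul1mx mulmx1.
  - by move=> j; rewrite /fconj !invmxX exprS exprSr !mulmxA.
  - move=> j hj; rewrite /phiL /= /phi; apply/eqP; rewrite subr_eq0; apply/eqP.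
    exact: commute_on_axis hj.
have [ba bb _ _ _] := hax.
have [h|h] : hform (g *m a) a = 0 \/ hform (g *m b) b = 0.
  apply: (commuting_conjugates_fix hf hg hax) => k.
  have := hall k; rewrite /phiL /= /phi /fconj invmxX => /eqP.
  by rewrite subr_eq0 => /eqP.
- have hfa : fixes g a.
    by apply: contrapT => hno; move/eqP: (moved_null ba hno); apply.
  by apply: hg2; split=> //; exact: (discrete_fix_one_end hS hd hSf hSg hax hfa).
- have hfb : fixes g b.
    by apply: contrapT => hno; move/eqP: (moved_null bb hno); apply.
  apply: hg2; split=> //.
  exact: (discrete_fix_one_end hS hd (sgV hS hSf) hSg (lox_axis_inv hf hax) hfb).
Qed.

End MinimalElement.

(** * Small elements fix a loxodromic axis *)

Section AxisRigidity.
Variables (R : realType) (n : nat).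
Local Notation C := (R[i]).
Local Notation nc := (@Normc.normc R).
Local Notation mx := ('M[C]_(n.+1)).
Local Notation vec := ('cV[C]_(n.+1)).
Local Notation cJ := (@cJ R n).
Local Notation E := (@near1_bound R n).

(** The radius [d] is chosen before [S]: later the discrete group varies with the small element. *)
Lemma discrete_small_fix_axis (f : mx) (a b : vec) l : in_U f -> lox_axis f a b l ->
  exists d : R, 0 < d /\ forall S g, is_PU_subgroup S -> discrete S -> S f -> S g ->
    mn (g - 1%:M) < d -> fixes g a /\ fixes g b.
Proof.
move=> hf hax; have [_ _ hab _ _] := hax.
set K := conj_const R n ^+ n.+1 * power_const f * n.+2%:R.
have K0 : 0 < K.
  rewrite !mulr_gt0 ?ltr0n ?exprn_gt0 //.
    by rewrite (lt_le_trans _ (conj_const_ge1 _ _)).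
  by rewrite (lt_le_trans _ (power_const_ge1 _)).
set K' := cJ * mn a * mn b + 1.
have K0' : 0 < K' by rewrite ltr_wpDl // !mulr_ge0 ?mn_ge0.
exists (Num.min (small_eps R n / K) (nc (hform a b) / K')).
split; first by rewrite lt_min !divr_gt0 ?small_eps_gt0 ?nc_gt0.
move=> S g0 hS hd hSf hSg0 hnear; apply: contrapT => hno.
have [|g [[hSg hg2] hgd hmin]] :=
  @near_minimal _ _ S (fun g => S g /\ ~ fix2 a b g) _ g0 hS hd _ (conj hSg0 hno) hnear.
  move=> g [hSg hg2]; split=> // hp; apply: hg2.
  by split; apply: pu_eq_fix hp _; apply: fix1.
move: hgd; rewrite lt_min !ltr_pdivlMr // => /andP[h1 h2].
apply: (minimal_element_absurd hS hd hSf hax hSg hg2 _ h1 h2) => g' hSg' hg2'.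
exact: hmin.
Qed.

Lemma lox_axis_conj (f g : mx) (a b : vec) l : in_U f -> in_U g -> lox_axis f a b l ->
  lox_axis (g *m f *m invmx g) (g *m a) (g *m b) l.
Proof.
move=> hf hg [/on_bdP[a0 qa] /on_bdP[b0 qb] hab hl [ha hb]]; have hgu := U_unit hg.
split=> //.
- by apply/on_bdP; split; [exact: unit_mul_neq0 | rewrite qfU].
- by apply/on_bdP; split; [exact: unit_mul_neq0 | rewrite qfU].
- by rewrite hformU.
- by split; rewrite -!mulmxA mulKmx // ?ha ?hb -scalemxAr.
Qed.

(** Discreteness is available only for the group generated by [f] and [k = g f g^-1], which contains
    the small commutator [k f^-1]. Once this fixes [a] and [b], so does [k]; then [f] fixes their
    preimages under [g], which must again be [a] or [b]. *)
Lemma lox_small_fix_axis (G : mx -> Prop) (f : mx) (a b : vec) l :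
  is_PU_subgroup G ->
  (forall f g, G f -> G g -> loxodromic f -> loxodromic g -> discrete (gen f g)) ->
  G f -> lox_axis f a b l ->
  exists d : R, 0 < d /\ forall g, G g -> mn (g - 1%:M) < d -> fixes g a /\ fixes g b.
Proof.
move=> hG hH hGf hax; have hf := sgU hG hGf; have hfu := U_unit hf.
have [ba bb hab hl [ha hb]] := hax.
have [d [d0 hd]] := discrete_small_fix_axis hf hax.
(* Bounds the norm of [k f^-1 - 1] relative to that of [g - 1]: two terms containing [f], then the
   inverses of [g] and of [f]. *)
set K := 2 * mn f * (cJ ^+ 2 * E) * (cJ ^+ 2 * mn f) + 1.
have E0 : 0 <= E := le_trans ler01 (near1_bound_ge1 R n).
have K0 : 0 < K.
  by rewrite ltr_wpDl // !mulr_ge0 ?mn_ge0 // ?sqr_ge0.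
set K' := cJ * mn a * mn b + 1.
have K0' : 0 < K' by rewrite ltr_wpDl // !mulr_ge0 ?mn_ge0.
exists (Num.min 1 (Num.min (d / K) (nc (hform a b) / K'))).
split; first by rewrite !lt_min ltr01 !divr_gt0 ?nc_gt0.
move=> g hGg; rewrite !lt_min !ltr_pdivlMr // => /and3P[h1 h2 h3].
have hg := sgU hG hGg; have hgu := U_unit hg.
set k := g *m f *m invmx g.
have hGk : G k by do !apply: sgM => //; apply: sgV.
have hk := sgU hG hGk.
have hS := gen_subgroup hf hk.
have hdS : discrete (gen f k).
  apply: hH => //; first exact: axis_loxodromic hf hax.
  exact: axis_loxodromic hk (lox_axis_conj hf hg hax).
have hcomm : mn (k *m invmx f - 1%:M) < d.
  apply: le_lt_trans h2.
  have -> : k *m invmx f - 1%:M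
      = ((g - 1%:M) *m f - f *m (g - 1%:M)) *m (invmx g *m invmx f).
    have -> : (g - 1%:M) *m f - f *m (g - 1%:M) = g *m f - f *m g.
      by rewrite mulmxBl mulmxBr mul1mx mulmx1 opprB addrA subrK.
    rewrite mulmxBl /k !mulmxA; congr (_ - _).
    by rewrite -(mulmxA f) mulmxV // mulmx1 mulmxV.
  apply: (le_trans (mnM _ _)).
  have hA : mn ((g - 1%:M) *m f - f *m (g - 1%:M)) <= 2 * mn f * mn (g - 1%:M).
    apply: (le_trans (mnB _ _)).
    have := mnM (g - 1%:M) f; have := mnM f (g - 1%:M).
    rewrite [mn (g - 1%:M) * mn f]mulrC; lra.
  have hB : mn (invmx g *m invmx f) <= (cJ ^+ 2 * E) * (cJ ^+ 2 * mn f).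
    apply: (le_trans (mnM _ _)); apply: ler_pM; rewrite ?mn_ge0 //.
      by apply: mn_inv_near1 => //; apply: ltW.
    exact: mn_invmx.
  apply: (@le_trans _ _ (2 * mn f * mn (g - 1%:M) * ((cJ ^+ 2 * E) * (cJ ^+ 2 * mn f)))).
    by apply: ler_pM; rewrite ?mn_ge0.
  have -> : 2 * mn f * mn (g - 1%:M) * ((cJ ^+ 2 * E) * (cJ ^+ 2 * mn f))
     = mn (g - 1%:M) * (2 * mn f * (cJ ^+ 2 * E) * (cJ ^+ 2 * mn f)) by ring.
  by rewrite ler_wpM2l ?mn_ge0 // lerDl.
have hSf : gen f k f := @gen_l _ _ f k.
have hSc : gen f k (k *m invmx f).
  by apply: (sgM hS); [exact: gen_r | exact: (sgV hS hSf)].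
have [hca hcb] := hd _ _ hS hdS hSf hSc hcomm.
have hback x : fixes (k *m invmx f) x -> fixes f x -> fixes f (invmx g *m x).
  move=> h4 h5; have := fixM h4 h5; rewrite (mulmxKV hfu k) => h6.
  by apply: (@fix_conj _ _ f (invmx g)); [rewrite unitmx_inv | rewrite invmxK].
(* These pairings prevent [g] from exchanging the two ends. *)
have pair_ab : hform (g *m a) b != 0 by apply: (@moved_pairing _ _ a b g h3).
have pair_ba : hform (g *m b) a != 0.
  by apply: (@moved_pairing _ _ a b g h3); [exact: mulrC | rewrite hformC ncJ].
have hpres x : on_bd x -> fixes f x -> fixes (k *m invmx f) x ->
    (exists2 c, c != 0 & x = c *: (g *m a)) \/ (exists2 c, c != 0 & x = c *: (g *m b)).
  move=> /on_bdP[x0 qx] hfx hx; have hVu : invmx g \in unitmx by rewrite unitmx_inv.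
  have h5 : invmx g *m x != 0 by exact: unit_mul_neq0.
  have h6 : qf (invmx g *m x) <= 0 by rewrite qfU ?qx //; exact: in_UV.
  have [[c c0 hc]|[c c0 hc]] := axis_fixcl hf hax h5 h6 (hback x hx hfx).
    by left; exists c => //; rewrite scalemxAr -hc mulKVmx.
  by right; exists c => //; rewrite scalemxAr -hc mulKVmx.
have hfa : fixes f a by exists l.
have hfb : fixes f b by exists (l^*)^-1.
have [[_ qa] [_ qb]] := (ba, bb).
split.
  have [[c c0 hc]|[c c0 hc]] := hpres a ba hfa hca.
    by exists c^-1; rewrite {2}hc scalerA mulVf // scale1r.
  move/eqP: pair_ba; case; apply: (mulfI c0).
  by rewrite -hformZl -hc qa mulr0.
have [[c c0 hc]|[c c0 hc]] := hpres b bb hfb hcb.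
  move/eqP: pair_ab; case; apply: (mulfI c0).
  by rewrite -hformZl -hc qb mulr0.
by exists c^-1; rewrite {2}hc scalerA mulVf // scale1r.
Qed.

End AxisRigidity.

(** * Fixed points in the closed ball and limits of powers *)

Section NonEllipticElements.
Variables (R : realType) (n : nat).
Local Notation C := (R[i]).
Local Notation nc := (@Normc.normc R).
Local Notation mx := ('M[C]_(n.+1)).
Local Notation vec := ('cV[C]_(n.+1)).
Local Notation J := (@Jmx R n).
Local Notation cJ := (@cJ R n).

Lemma row_eigenvector_in (m : nat) (V f : 'M[C]_m) : (0 < \rank V)%N -> (V *m f <= V)%MS ->
  exists2 v : 'rV[C]_m, v != 0 & (v <= V)%MS /\ exists l, v *m f = l *: v.
Proof.
move=> rV hV; set W := row_base V.
pose g := W *m f *m pinvmx W.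
have hWf : W *m f = g *m W.
  by rewrite mulmxKpV // (eqmxMr _ (eq_row_base V)) eq_row_base.
have : size (char_poly g) != 1%N by rewrite size_char_poly eqSS -lt0n.
case/closed_rootP => l; rewrite -eigenvalue_root_char => /eigenvalueP [u hu u0].
exists (u *m W).
  by rewrite mulmx_free_eq0 // row_base_free.
split; first by rewrite (submx_trans (submxMl _ _)) // eq_row_base.
by exists l; rewrite -mulmxA hWf mulmxA hu -scalemxAl.
Qed.

(** Induction on the dimension of an invariant subspace containing a negative vector. If an
    eigenvector found in it is positive, its orthogonal complement there is invariant, smaller, and
    still contains a negative vector. This stands in for a topological fixed point theorem. *)
Lemma closure_eigenvector_in (A : mx) : in_U A -> forall r (V : mx), (\rank V <= r)%N ->
  (V *m A^T <= V)%MS -> forall z, (z^T <= V)%MS -> qf z < 0 ->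
  exists v l, [/\ v != 0, qf v <= 0 & A *m v = l *: v].
Proof.
move=> hA.
have hrk (V : mx) (z : vec) : (z^T <= V)%MS -> qf z < 0 -> (0 < \rank V)%N.
  move=> hz /neg_neq0 z0; rewrite lt0n mxrank_eq0; apply: contra z0 => /eqP V0.
  by rewrite -(inj_eq trmx_inj) trmx0 -submx0 -V0.
elim=> [|r IH] V hr hV z hz qz; have rV := hrk V z hz qz; first by rewrite leqNgt rV in hr.
have [u u0 [huV [l hu]]] := row_eigenvector_in rV hV.
pose v : vec := u^T.
have v0 : v != 0 by rewrite -(inj_eq trmx_inj) trmxK trmx0.
have hv : A *m v = l *: v.
  by apply: trmx_inj; rewrite trmx_mul trmxK hu linearZ /= trmxK.
have [qv|qv] := leP (qf v) 0; first by exists v, l.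
pose F := (adjmx v *m J)^T.
have hF (x : vec) : (x^T *m F == 0) = (hform x v == 0).
  rewrite -trmx_mul -(inj_eq trmx_inj) trmxK trmx0.
  apply/eqP/eqP => [h|h]; first by rewrite /hform h mxE.
  by apply/matrixP => i j; rewrite (ord1 i) (ord1 j) [RHS]mxE.
have hvv : hform v v != 0 by rewrite hform_eq0 gt_eqF.
have l0 := eigen_neq0 hA v0 hv.
(* Removing the component along a positive vector can only decrease [qf]. *)
pose z' := z - (hform z v / hform v v) *: v.
have hz'v : hform z' v = 0.
  by rewrite hformDl hformNl hformZl mulfVK // subrr.
apply: (IH (V :&: kermx F)%MS _ _ z').
- rewrite -ltnS; apply: leq_trans hr; apply: rank_ltmx.
  rewrite /ltmx capmxSl /=; apply: contra hvv => hle.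
  have /sub_kermxP huF : (u <= kermx F)%MS.
    by apply: (submx_trans huV); apply: (submx_trans hle); rewrite capmxSr.
  by rewrite -hF trmxK huF.
- apply/row_subP => i; rewrite row_mul.
  have : (row i (V :&: kermx F)%MS <= V :&: kermx F)%MS by apply: row_sub.
  move: (row i _) => w; rewrite !sub_capmx => /andP[hwV /sub_kermxP hwF].
  rewrite (submx_trans (submxMr _ hwV) hV) /=; apply/sub_kermxP/eqP.
  have -> : w *m A^T = (A *m w^T)^T by rewrite trmx_mul trmxK.
  rewrite hF; apply/eqP.
  have hw : hform w^T v = 0 by apply/eqP; rewrite -hF trmxK hwF.
  have lc : l^* != 0 by rewrite conjC_eq0.
  by apply: (mulfI lc); rewrite -hformZr -hv hformU // hw mulr0.
- rewrite sub_capmx; apply/andP; split; last by apply/sub_kermxP/eqP; rewrite hF hz'v.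
  rewrite /z' linearB linearZ /= trmxK addmx_sub // -scaleN1r !scalemx_sub //.
- have hE : z = z' + (hform z v / hform v v) *: v by rewrite subrK.
  have : qf z = qf z' + nc (hform z v / hform v v) ^+ 2 * qf v.
    by rewrite -ncN -qf_sub // scaleNr opprK -hE.
  by have := mulr_ge0 (sqr_ge0 (nc (hform z v / hform v v))) (ltW qv); lra.
Qed.

Lemma closure_eigenvector (A : mx) : in_U A ->
  exists v l, [/\ v != 0, qf v <= 0 & A *m v = l *: v].
Proof.
move=> hA; apply: (closure_eigenvector_in hA (r := n.+1) (V := 1%:M) _ _ (z := delta_mx 0 0)).
- by rewrite mxrank1.
- exact: submx1.
- exact: submx1.
- rewrite /qf big1 => [|i _]; last by rewrite mxE nc0 expr0n.
  by rewrite mxE eqxx nc1 expr1n sub0r oppr_lt0.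
Qed.

(** Holds for non-elliptic elements of infinite order; [~ elliptic] alone would admit the
    identity. *)
Definition no_negative_fixed (A : mx) : Prop := forall z, in_H z -> ~ fixes A z.

(** If [<y,a>] were nonzero, the fixed vector [a + t y] would be negative for a small [t] of
    suitable phase. *)
Lemma fixed_vectors_orth (T : mx) (a y : vec) : no_negative_fixed T ->
  on_bd a -> T *m a = a -> T *m y = y -> hform y a = 0.
Proof.
move=> hno /on_bdP[a0 qa] ha hy; apply/eqP; apply: contrapT => /negP hya.
(* With this [s] the quadratic term [s^2 qf y] is at most [s], below the linear term [2 s]. *)
set p := hform y a in hya *; set s : R := (`|qf y| + 1)^-1.
have s0 : 0 < s by rewrite invr_gt0 ltr_wpDl.
pose t : C := - (real_complex R s * p^*).
apply: (hno (a + t *: y)); last first.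
  by exists 1; rewrite mulmxDr -scalemxAr ha hy scale1r.
rewrite /in_H hform_lt0.
have rcN (x : R) : real_complex R (- x) = - real_complex R x by exact: rmorphN.
have conjR (x : R) : (real_complex R x)^* = real_complex R x by exact: conjc_real.
have htc : t^* = - (real_complex R s * p).
  by rewrite /t rmorphN /= conjM conjR conjCK.
have -> : qf (a + t *: y) = nc p ^+ 2 * (s * (s * qf y) - (s + s)).
  apply: (@complexI R); rewrite -hform_qf !(hformDl, hformDr, hformZl, hformZr).
  rewrite !hform_qf qa (hformC y a) -/p htc [RHS]rcM nc_sq [X in _ = _ * X]rcD rcN rcD !rcM.
  by rewrite -[real_complex R 0]/(0 : C) /t; ring.
rewrite pmulr_rlt0 ?exprn_gt0 ?nc_gt0 //.
have -> : s * (s * qf y) - (s + s) = s * (s * qf y - 2) by ring.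
rewrite pmulr_rlt0 //.
have : s * qf y <= 1; last by lra.
apply: (@le_trans _ _ (s * `|qf y|)); first by rewrite ler_wpM2l ?ler_norm // ltW.
by rewrite /s mulrC ler_pdivrMr ?ltr_wpDl // mul1r lerDl.
Qed.

(** If kernel and range of [T - 1] met only in 0, they would span the space. Both are orthogonal to
    [a], the kernel by [fixed_vectors_orth] and the range by invariance, against nondegeneracy. A
    common nonzero vector is the required [x]. *)
Lemma unit_null_jordan (T : mx) (a : vec) : in_U T -> no_negative_fixed T ->
  on_bd a -> T *m a = a ->
  exists w x : vec, [/\ x != 0, T *m x = x & T *m w = w + x].
Proof.
move=> hT hno ba ha; set B := (T - 1%:M)^T.
have hB (u : 'rV[C]_n.+1) : (u *m B)^T = T *m u^T - u^T.
  by rewrite trmx_mul trmxK mulmxBl mul1mx.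
have [hcap|hcap] := boolP ((kermx B :&: B)%MS == 0); last first.
  have [v hv v0] := rowV0Pn hcap; move: hv; rewrite sub_capmx.
  case/andP=> /sub_kermxP hker /submxP [u hu].
  exists u^T, v^T; split.
  - by rewrite -(inj_eq trmx_inj) trmxK trmx0.
  - by apply/eqP; rewrite -subr_eq0 -hB hker trmx0.
  - by rewrite hu hB addrC subrK.
have [a0 _] := ba; case/eqP: a0; apply: hform_nondeg => x.
have hfull : (1%:M <= kermx B + B)%MS.
  rewrite sub1mx /row_full; have := mxrank_sum_cap (kermx B) B.
  by rewrite (eqP hcap) mxrank0 addn0 mxrank_ker subnK ?rank_leq_col // => ->.
have : (x^T <= kermx B + B)%MS by apply: submx_trans hfull; apply: submx1.
case/sub_addsmxP => -[u1 u2] /= hx.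
have -> : x = (u1 *m kermx B)^T + (u2 *m B)^T by rewrite -linearD /= -hx trmxK.
rewrite hformDl; have -> : hform (u1 *m kermx B)^T a = 0.
  apply: (fixed_vectors_orth hno ba ha); apply/eqP; rewrite -subr_eq0 -hB.
  by rewrite -mulmxA mulmx_ker mulmx0 trmx0.
by rewrite add0r hB hformDl hformNl -{1}ha hformU // subrr.
Qed.

Lemma zero_of_small (X c : R) (u : nat -> R) : 0 <= X -> 0 <= c ->
  (forall e, 0 < e -> exists k, u k < e) -> (forall k, X <= c * u k) -> X = 0.
Proof.
move=> X0 c0 hu h; apply/eqP; rewrite eq_le X0 andbT; apply/ler_addgt0Pl => e e0.
have [|k hk] := hu (e / (c + 1)); first by rewrite divr_gt0 // ltr_wpDl.
rewrite addr0; apply: (le_trans (h k)); apply: (@le_trans _ _ ((c + 1) * (e / (c + 1)))).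
  have [u0|u0] := leP 0 (u k).
    by apply: ler_pM; rewrite ?(ltW hk) // lerDl.
  apply: (@le_trans _ _ 0); first by rewrite mulr_ge0_le0 // ltW.
  by rewrite mulrC mulfVK ?ltW // gt_eqF // ltr_wpDl.
by rewrite mulrC mulfVK // gt_eqF // ltr_wpDl.
Qed.

(* [<Pv,a>] and [<Pv,Pv>] are limits of [<v,a> / t k] and [<v,v> / t k ^+ 2], so they vanish. *)
Lemma rescaled_limit_range (B : nat -> mx) (t : nat -> R) (P : mx) (a : vec) (c : R) :
  (forall k, in_U (B k)) -> (forall k, B k *m a = a) -> on_bd a ->
  (forall k, 1 <= t k) -> (forall k, mn (B k) <= c * t k) ->
  (forall e, 0 < e -> exists k,
     mn (real_complex R (t k)^-1 *: B k - P) + (t k)^-1 < e) ->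
  forall v, exists s, P *m v = s *: a.
Proof.
move=> hB hBa ba ht hc hlim v; have [a0 qa] := (on_bdP a).1 ba.
pose A k := real_complex R (t k)^-1 *: B k.
have t0 k : 0 < t k by rewrite (lt_le_trans _ (ht k)).
have hA k : mn (A k) <= c.
  rewrite /A mnZ ncR ger0_norm ?invr_ge0 ?(ltW (t0 k)) //.
  by rewrite mulrC ler_pdivrMr.
have cJ0 : 0 <= cJ by exact: mn_ge0.
have c0 : 0 <= c := le_trans (mn_ge0 _) (hA 0%N).
have hPv k : mn (P *m v - A k *m v) <= mn (A k - P) * mn v.
  by rewrite -mulmxBl; apply: (le_trans (mnM _ _)); rewrite -(mnN (P - _)) opprB.
have form0 (w : vec) (K : R) : 0 <= K ->
    (forall k, nc (hform (P *m v) w) <= K * (mn (A k - P) + (t k)^-1)) ->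
    hform (P *m v) w = 0.
  move=> K0 h; apply/eqP; rewrite -nc_eq0; apply/eqP.
  by apply: (zero_of_small _ K0 hlim h); exact: nc_ge0.
have rtk k : 0 <= (t k)^-1 by rewrite invr_ge0 ltW.
have hsplit k w : nc (hform (P *m v) w) <=
    cJ * (mn (A k - P) * mn v) * mn w + nc (hform (A k *m v) w).
  have -> : P *m v = (P *m v - A k *m v) + A k *m v by rewrite subrK.
  rewrite hformDl; apply: (le_trans (ncD _ _)); rewrite lerD2r.
  apply: (le_trans (nc_hform _ _)).
  by rewrite ler_wpM2r ?mn_ge0 // ler_wpM2l.
have hAE k w : nc (hform (A k *m v) w) = (t k)^-1 * nc (hform (B k *m v) w).
  by rewrite /A -scalemxAl hformZl ncM ncR ger0_norm.
have key (x y u w : R) : 0 <= x -> 0 <= y -> 0 <= u -> 0 <= w ->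
    x * u + w * y <= (x + y) * (u + w).
  by move=> x0 y0 u0 w0; have := mulr_ge0 x0 w0; have := mulr_ge0 y0 u0; nra.
have hPva : hform (P *m v) a = 0.
  pose K1 := cJ * mn v * mn a; pose K2 := nc (hform v a).
  have K10 : 0 <= K1 by rewrite !mulr_ge0 ?mn_ge0.
  apply: (form0 _ (K1 + K2)) => [|k]; first by rewrite addr_ge0 ?nc_ge0.
  apply: (le_trans (hsplit k _)); rewrite hAE.
  have -> : hform (B k *m v) a = hform v a by rewrite -{1}(hBa k) hformU.
  rewrite -/K2.
  have -> : cJ * (mn (A k - P) * mn v) * mn a = K1 * mn (A k - P) by rewrite /K1; ring.
  exact: key K10 (nc_ge0 _) (mn_ge0 _) (rtk k).
have hPvv : hform (P *m v) (P *m v) = 0.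
  pose K1 := cJ * mn v * mn (P *m v) + cJ * (c * mn v) * mn v; pose K2 := nc (hform v v).
  have K10 : 0 <= K1 by rewrite addr_ge0 ?mulr_ge0 ?mn_ge0.
  apply: (form0 _ (K1 + K2)) => [|k]; first by rewrite addr_ge0 ?nc_ge0.
  apply: (le_trans (hsplit k _)).
  have h1 : nc (hform (A k *m v) (P *m v)) <= cJ * (c * mn v) * (mn (A k - P) * mn v) + (t k)^-1 * K2.
    have {1}-> : P *m v = (P *m v - A k *m v) + A k *m v by rewrite subrK.
    rewrite hformDr; apply: (le_trans (ncD _ _)); apply: lerD.
      apply: (le_trans (nc_hform _ _)); apply: ler_pM; rewrite ?mulr_ge0 ?mn_ge0 //.
      rewrite ler_wpM2l //; apply: (le_trans (mnM _ _)).
      by rewrite ler_wpM2r ?mn_ge0.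
    rewrite hAE; have -> : nc (hform (B k *m v) (A k *m v)) = (t k)^-1 * K2.
      by rewrite hformC ncJ hAE hformU.
    rewrite ler_wpM2l // ler_piMl ?nc_ge0 // invf_le1 //.
  apply: (le_trans (lerD (lexx _) h1)).
  have -> : cJ * (mn (A k - P) * mn v) * mn (P *m v) +
      (cJ * (c * mn v) * (mn (A k - P) * mn v) + (t k)^-1 * K2)
      = K1 * mn (A k - P) + (t k)^-1 * K2 by rewrite /K1; ring.
  exact: key K10 (nc_ge0 _) (mn_ge0 _) (rtk k).
apply: null_orth => //.
by rewrite -hform_le0 hPvv.
Qed.

(** The trace is the sum of the [n + 1] roots of the characteristic polynomial. Used in reverse: a
    large trace yields an eigenvalue off the unit circle. *)
Lemma trace_unit_eigenvalues (A : mx) :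
  (forall (v : vec) l, v != 0 -> A *m v = l *: v -> nc l = 1) ->
  nc (\tr A) <= n.+1%:R.
Proof.
move=> h; have [rs hrs] := closed_field_poly_normal (char_poly A^T).
have hmon : lead_coef (char_poly A^T) = 1 := monicP (char_poly_monic _).
rewrite hmon scale1r in hrs.
have hsize : size rs = n.+1.
  by have := size_char_poly A^T; rewrite hrs size_prod_XsubC => -[].
have htr : \tr A = \sum_(r <- rs) r.
  have := @char_poly_trace _ _ A^T isT; rewrite mxtrace_tr hrs -{1}hsize.
  rewrite coefPn_prod_XsubC ?hsize // => /oppr_inj -> //.
rewrite htr; apply: (le_trans (nc_sum _ _ _)).
have -> : n.+1%:R = \sum_(r <- rs) (1 : R).
  by rewrite big_const_seq count_predT hsize iter_addr_0.
rewrite big_seq [leRHS]big_seq; apply: ler_sum => r hr.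
have : eigenvalue A^T r by rewrite eigenvalue_root_char hrs root_prod_XsubC.
case/eigenvalueP => u hu u0; rewrite (h u^T r) //.
  by rewrite -(inj_eq trmx_inj) trmxK trmx0.
by apply: trmx_inj; rewrite trmx_mul trmxK hu linearZ /= trmxK.
Qed.

End NonEllipticElements.

(** * Existence of loxodromic elements with different axes *)

Section LoxodromicExistence.
Variables (R : realType) (n : nat).
Local Notation C := (R[i]).
Local Notation nc := (@Normc.normc R).
Local Notation mx := ('M[C]_(n.+1)).
Local Notation vec := ('cV[C]_(n.+1)).
Local Notation J := (@Jmx R n).
Local Notation cJ := (@cJ R n).

Lemma nc_trace (A : mx) : nc (\tr A) <= mn A.
Proof.
apply: (le_trans (nc_sum _ _ _)); apply: ler_sum => i _.
by rewrite (bigD1 i) //= lerDl sumr_ge0 // => j _; exact: nc_ge0.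
Qed.

Lemma mx_ext (P Q : mx) : (forall v : vec, P *m v = Q *m v) -> P = Q.
Proof.
move=> h; apply/matrixP => i j.
have e (X : mx) : X i j = (X *m (delta_mx j 0 : vec)) i 0 by rewrite -colE [RHS]mxE.
by rewrite e h -e.
Qed.

Lemma rank_one_form (a v : vec) : (a *m (adjmx a *m J)) *m v = hform v a *: a.
Proof.
rewrite -mulmxA; have -> : adjmx a *m J *m v = (hform v a)%:M by exact: mx11_scalar.
by rewrite mul_mx_scalar.
Qed.

Lemma hform_adjoint (P : mx) (v w : vec) :
  hform (P *m v) w = hform v (J *m adjmx P *m J *m w).
Proof.
by rewrite /hform !adjmxM adjmxK adjJ !mulmxA -(mulmxA (adjmx w *m J *m P) J J) JmxK mulmx1.
Qed.

(* The limit of the rescaled powers [T ^+ k] is a multiple of [v |-> <v,a> a]. *)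
Lemma parabolic_trace_unbounded (T g : mx) (a w x : vec) (M : R) :
  in_U T -> on_bd a -> T *m a = a -> x != 0 -> T *m x = x -> T *m w = w + x ->
  hform (g *m a) a != 0 -> (forall k, nc (\tr (T ^+ k *m g)) <= M) -> False.
Proof.
move=> hT ba ha x0 hx hw hga htr; have [a0 qa] := (on_bdP a).1 ba.
have hTk k := in_UX k hT.
have hTa k : T ^+ k *m a = a.
  by have := @eigenX _ _ T a 1 k; rewrite scale1r expr1n scale1r; apply.
have hTw k : T ^+ k *m w = w + k%:R *: x.
  elim: k => [|k IH]; first by rewrite expr0 mul1mx scale0r addr0.
  have hTx : T *m x = 1 *: x by rewrite scale1r.
  rewrite exprSr -mulmxA hw mulmxDr IH (eigenX k hTx) expr1n -addrA -scalerDl.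
  by rewrite -natr1.
pose t k := mn (T ^+ k).
have w0 : w != 0.
  apply: contra x0 => /eqP w0; apply/eqP.
  by move: hw; rewrite w0 mulmx0 add0r => <-.
have mw := mn_gt0 w0; have mx := mn_gt0 x0; have ma := mn_gt0 a0.
have ht k : 1 <= t k.
  by rewrite -(ler_pM2r ma) mul1r -{1}(hTa k) mnM.
have t0 k : 0 < t k := lt_le_trans ltr01 (ht k).
(* The Jordan pair forces at least linear growth of the norms [t k]. *)
have hgrow k : k%:R * mn x <= (1 + t k) * mn w.
  have -> : k%:R * mn x = mn (T ^+ k *m w - w).
    rewrite hTw addrC addKr mnZ -(rmorph_nat (real_complex R)) ncR ger0_norm //.
  apply: (le_trans (mnB _ _)); rewrite mulrDl mul1r addrC lerD2l; exact: mnM.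
pose A k := real_complex R (t k)^-1 *: T ^+ k.
have hA k : mn (A k) = 1.
  rewrite /A mnZ ncR ger0_norm ?invr_ge0 ?(ltW (t0 k)) // mulVf // gt_eqF //.
have [P hP] := bounded_cluster (M := 1) (A := A) (fun k => eq_ind_r (fun y => y <= 1) (lexx 1) (hA k)).
have hlim e : 0 < e -> exists k, mn (A k - P) + (t k)^-1 < e.
  move=> e0; have e2 : 0 < e / 2 by rewrite divr_gt0.
  pose y := (2 / e + 1) * mn w / mn x.
  have y0 : 0 <= y.
    by rewrite /y divr_ge0 ?mn_ge0 // mulr_ge0 ?mn_ge0 // addr_ge0 // divr_ge0 // ltW.
  have := archi_boundP y0; set K := Num.bound y; rewrite ltr_pdivrMr // => hK.
  have [k [hkK hk]] := hP _ e2 K; exists k.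
  have hKk : K%:R <= k%:R :> R by rewrite ler_nat.
  have h1 : (2 / e + 1) * mn w < (1 + t k) * mn w.
    apply: (lt_le_trans hK); apply: (le_trans _ (hgrow k)).
    by rewrite ler_wpM2r ?mn_ge0.
  rewrite ltr_pM2r // addrC ltrD2l in h1.
  have h2 : (t k)^-1 < e / 2.
    by rewrite -[e / 2]invrK ltf_pV2 ?posrE ?invr_gt0 // invfM invrK mulrC.
  by have := ltrD hk h2; rewrite -splitr.
have hPv := @rescaled_limit_range _ _ (fun k => T ^+ k) t P a 1 hTk hTa ba ht
  (fun k => eq_ind_r (fun y => t k <= y) (lexx _) (mul1r (t k))) hlim.
(* The adjoint of [P] for the form, and a limit of the rescaled inverse powers; so it too has range
   in the line of [a], which determines [P] up to a scalar. *)
set Q := J *m adjmx P *m J.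
have hQw : forall w, exists s, Q *m w = s *: a.
  apply: (@rescaled_limit_range _ _ (fun k => invmx (T ^+ k)) t Q a (cJ ^+ 2)) => //.
  - by move=> k; apply: in_UV.
  - by move=> k; apply: (canLR (mulKmx (U_unit (hTk k)))); rewrite hTa.
  - by move=> k; apply: mn_invmx.
  move=> e e0; have c0 : 0 < cJ ^+ 2 + 1 by rewrite ltr_wpDl ?sqr_ge0.
  have [|k hk] := hlim (e / (cJ ^+ 2 + 1)); first by rewrite divr_gt0.
  exists k; move: hk; rewrite ltr_pdivlMr // => hk; apply: le_lt_trans hk.
  have -> : real_complex R (t k)^-1 *: invmx (T ^+ k) - Q = J *m adjmx (A k - P) *m J.
    have -> : adjmx (A k - P) = real_complex R (t k)^-1 *: adjmx (T ^+ k) - adjmx P.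
      apply/matrixP => i j; rewrite !mxE rmorphB rmorphM /=; congr (_ * _ - _).
      exact: conjc_real.
    by rewrite invmxU // mulmxBr mulmxBl -scalemxAr -scalemxAl.
  have h1 : mn (J *m adjmx (A k - P) *m J) <= cJ ^+ 2 * mn (A k - P).
    apply: (le_trans (mnM _ _)); rewrite expr2 -/cJ mulrAC ler_wpM2r ?mn_ge0 //.
    by apply: (le_trans (mnM _ _)); rewrite mn_adj.
  have h2 : 0 <= (t k)^-1 by rewrite invr_ge0 ltW.
  have h3 := mulr_ge0 (sqr_ge0 cJ) h2; have h4 := mn_ge0 (A k - P).
  apply: (le_trans (lerD h1 (lexx _))); rewrite mulrC; lra.
have [b hb] : exists b, hform b a != 0.
  apply: contrapT => hno; case/eqP: a0; apply: hform_nondeg => y.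
  by apply/eqP; apply: contrapT => /negP hy; apply: hno; exists y.
have hab := hform_neq0C hb.
have [s hs] := hQw b; pose kap := s^* / hform a b.
have hPE : P = kap *: (a *m (adjmx a *m J)).
  apply: mx_ext => v; rewrite -scalemxAl rank_one_form scalerA.
  have [p hp] := hPv v; rewrite hp; congr (_ *: _).
  have := hform_adjoint P v b; rewrite -/Q hs hformZr hp hformZl => hE.
  by rewrite /kap mulrAC -hE mulfK.
(* The rescaled powers have norm 1, so their cluster point is not 0. *)
have kap0 : kap != 0.
  apply/eqP => k0; have [|k [_ hk]] := hP 1 _ 0%N; first exact: ltr01.
  by move: hk; rewrite hPE k0 scale0r subr0 hA ltxx.
(* Bounded traces divided by [t k] tend to 0, whereas the trace of [P g] is [kap <g a, a>]. *)
have : nc (\tr (P *m g)) = 0.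
  have M0 : 0 <= M := le_trans (nc_ge0 _) (htr 0%N).
  apply: (@zero_of_small _ _ (mn g + M) (fun k => mn (A k - P) + (t k)^-1)) => //.
  - exact: nc_ge0.
  - by rewrite addr_ge0 ?mn_ge0.
  move=> k; have -> : P *m g = A k *m g - (A k - P) *m g.
    by rewrite -mulmxBl opprB addrC subrK.
  rewrite raddfB /=; apply: (le_trans (ncD _ _)); rewrite ncN.
  have h1 : nc (\tr (A k *m g)) <= (t k)^-1 * M.
    rewrite /A -scalemxAl mxtraceZ ncM ncR ger0_norm ?invr_ge0 ?(ltW (t0 k)) //.
    by rewrite ler_wpM2l ?invr_ge0 ?(ltW (t0 k)).
  have h2 : nc (\tr ((A k - P) *m g)) <= mn (A k - P) * mn g.
    by apply: (le_trans (nc_trace _)); exact: mnM.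
  apply: (le_trans (lerD h1 h2)).
  have h3 : 0 <= (t k)^-1 by rewrite invr_ge0 ltW.
  have := mulr_ge0 (mn_ge0 g) h3; have := mulr_ge0 M0 (mn_ge0 (A k - P)).
  by nra.
move/eqP; rewrite nc_eq0 hPE -scalemxAl mxtraceZ -!mulmxA mxtrace_mulC -!mulmxA.
rewrite mulf_eq0 (negPf kap0) /=.
have -> : adjmx a *m (J *m (g *m a)) = (hform (g *m a) a)%:M.
  by rewrite mulmxA; exact: mx11_scalar.
by rewrite mxtrace_scalar mulr1n (negPf hga).
Qed.

Lemma no_negative_fixed_cases (f : mx) : in_U f -> no_negative_fixed f ->
  (exists a b l, lox_axis f a b l) \/
  (exists a l, [/\ on_bd a, nc l = 1 & f *m a = l *: a]).
Proof.
move=> hf hno; have [a [l [a0 qa ha]]] := closure_eigenvector hf.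
have [/eqP hl|hl] := boolP (nc l == 1); last by left; apply: lox_axis_of_eigen ha hl.
right; exists a, l; split=> //; apply/on_bdP; split=> //.
apply/eqP; rewrite eq_le qa leNgt; apply/negP => hneg.
by apply: (hno a); [rewrite /in_H hform_lt0 | exists l].
Qed.

(** A second null fixed line would span with [a] a plane on which [f] is scalar, containing a
    negative fixed vector. *)
Lemma unit_null_unique (f : mx) (a z : vec) l : in_U f -> no_negative_fixed f ->
  on_bd a -> nc l = 1 -> f *m a = l *: a -> on_bd z -> fixes f z ->
  exists2 c, c != 0 & z = c *: a.
Proof.
move=> hf hno ba hl ha bz [m hz]; have [z0 qz] := (on_bdP z).1 bz.
apply: closure_orth_null => //; first by rewrite qz.
apply/eqP; apply: contrapT => /negP hza.
have [y [hy hfy]] := unit_eigen_negative hf ba bz (hform_neq0C hza) ha hz hl.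
by apply: (hno y hy); exists l.
Qed.

(** It remains to treat [f] and [g] with one boundary fixed point each. These differ, so [<g a, a>]
    is nonzero and the traces of [T^k g] are unbounded, whereas without loxodromic axes all
    eigenvalues in [G] would have modulus 1. *)
Lemma exists_lox_axis (G : mx -> Prop) (f g : mx) : is_PU_subgroup G ->
  G f -> G g -> no_negative_fixed f -> no_negative_fixed g ->
  ~ (forall z, fixbd f z <-> fixbd g z) ->
  exists h a b l, G h /\ lox_axis h a b l.
Proof.
move=> hG hGf hGg hnf hng hne; have hf := sgU hG hGf; have hg := sgU hG hGg.
have [[a [b [l hax]]]|[a [l [ba hl ha]]]] := no_negative_fixed_cases hf hnf.
  by exists f, a, b, l.
have [[b [c [m hax]]]|[b [m [bb hm hb]]]] := no_negative_fixed_cases hg hng.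
  by exists g, b, c, m.
have fixf z : fixbd f z <-> exists2 c, c != 0 & z = c *: a.
  split=> [[bz hz]|[c c0 ->]]; first exact: unit_null_unique ha bz hz.
  have [a0 qa] := ba; split; last by apply: fixZ; exists l.
  by split; [rewrite scaler_eq0 negb_or c0 | rewrite hformZl hformZr qa !mulr0].
have fixg z : fixbd g z <-> exists2 c, c != 0 & z = c *: b.
  split=> [[bz hz]|[c c0 ->]]; first exact: unit_null_unique hb bz hz.
  have [b0 qb] := bb; split; last by apply: fixZ; exists m.
  by split; [rewrite scaler_eq0 negb_or c0 | rewrite hformZl hformZr qb !mulr0].
have [a0 qa] := (on_bdP a).1 ba.
have hga : hform (g *m a) a != 0.
  apply/eqP => h.
  have [||c _ hc] := closure_orth_null ba _ _ h.
  - by apply: unit_mul_neq0 => //; apply: U_unit.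
  - by rewrite qfU // qa.
  have /fixg [e e0 hab] : fixbd g a by split=> //; exists c.
  apply: hne => z; rewrite fixf fixg; split=> [[p p0 ->]|[p p0 ->]].
    by exists (p * e); rewrite ?mulf_neq0 // hab scalerA.
  by exists (p / e); rewrite ?mulf_neq0 ?invr_eq0 // hab scalerA divfK.
have l0 : l != 0 by rewrite -nc_gt0 hl.
have hl1 : `|l^-1| = 1 by apply/eqP; rewrite nc_unit ncV hl invr1.
(* Normalised to have eigenvalue 1 at [a]. *)
pose T := l^-1 *: f.
have hGT : G T by apply: sgZ.
have hT := sgU hG hGT.
have hTa : T *m a = a by rewrite -scalemxAl ha scalerA mulVf // scale1r.
have hTno : no_negative_fixed T.
  move=> z hz [p hp]; apply: (hnf z hz); exists (l * p).
  by rewrite -scalerA -hp -scalemxAl scalerA mulfV // scale1r.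
have [w [x [x0 hx hw]]] := unit_null_jordan hT hTno ba hTa.
apply: contrapT => hnolox.
apply: (parabolic_trace_unbounded (M := n.+1%:R) hT ba hTa x0 hx hw hga) => k.
have hGk : G (T ^+ k *m g) by apply: sgM => //; apply: sgX.
apply: trace_unit_eigenvalues => v p v0 hv; apply/eqP; apply: contrapT => /negP hp.
have [c [d [q hax]]] := lox_axis_of_eigen (sgU hG hGk) v0 hv hp.
by apply: hnolox; exists (T ^+ k *m g), c, d, q.
Qed.

(** An isometry exchanging the ends of a geodesic fixes a point on it. With [p = <a, A a>] and
    [A^2 a = tau a], invariance makes [tau p] the conjugate of [p]. So [a - (p/|p|) A a] is an
    eigenvector, with [qf] equal to [-2 |p|]. *)
Lemma no_negative_fixed_no_swap (A : mx) (a b : vec) (s t : C) : in_U A ->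
  no_negative_fixed A -> on_bd a -> on_bd b -> hform a b != 0 ->
  A *m a = s *: b -> A *m b = t *: a -> False.
Proof.
move=> hA hno /on_bdP[a0 qa] /on_bdP[b0 qb] hab ha hb.
pose b' := A *m a; pose p := hform a b'; pose tau := s * t.
have hb' : A *m b' = tau *: a by rewrite /b' ha -scalemxAr hb scalerA.
have s0 : s != 0.
  apply/eqP => s0; have := unit_mul_neq0 (U_unit hA) a0.
  by rewrite ha s0 scale0r eqxx.
have p0 : p != 0 by rewrite /p /b' ha hformZr mulf_neq0 // conjC_eq0.
have hp : p = tau^* * p^*.
  rewrite -[LHS](hformU _ _ hA) -/b' hb' hformZr; congr (_ * _).
  exact: hformC.
have np0 : 0 < nc p by rewrite nc_gt0.
pose N := real_complex R (nc p).
have N0 : N != 0 by rewrite /N -nc_gt0 ncR ger0_norm ?nc_ge0.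
have hNN : N * N = p * p^* by rewrite -nc_sq expr2 [RHS]rcM.
have NJ : N^* = N by exact: conjc_real.
pose zeta := - (p / N).
have htp : tau * p = p^*.
  have h : p^* = (tau^* * p^*)^* by exact: (congr1 (fun y : C => y^*) hp).
  by rewrite h conjM !conjCK.
have hz : A *m (a + zeta *: b') = (zeta * tau) *: (a + zeta *: b').
  rewrite mulmxDr -scalemxAr -/b' hb' scalerDr !scalerA addrC; congr (_ + _).
  have -> : zeta * tau * zeta = 1; last by rewrite scale1r.
  have -> : zeta * tau * zeta = (tau * p) * p / (N * N).
    by rewrite /zeta; field.
  by rewrite htp hNN [p^* * p]mulrC mulfV // mulf_neq0 // conjC_eq0.
apply: (hno (a + zeta *: b')); last by exists (zeta * tau).
rewrite /in_H hform_lt0 hform_comb //; last by rewrite /b' qfU.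
have -> : zeta^* * hform a b' = - N.
  have conjN (y : C) : (- y)^* = - y^* by exact: rmorphN.
  rewrite -/p /zeta conjN conjM conjV NJ mulNr; congr (- _).
  by apply: (mulIf N0); rewrite hNN; field.
by rewrite /= mulrN oppr_lt0 mulr_gt0.
Qed.

(** Otherwise every [r] in [G] maps the points [a] and [b] into themselves, since [r h r^-1] or its
    inverse would serve as [k]. Without negative fixed vectors [r] cannot exchange them, so it fixes
    both and no other boundary point. Then [f] and [g] would have the same boundary fixed points. *)
Lemma exists_second_lox_axis (G : mx -> Prop) (f g h : mx) (a b : vec) l :
  is_PU_subgroup G -> G f -> G g -> no_negative_fixed f -> no_negative_fixed g ->
  ~ (forall z, fixbd f z <-> fixbd g z) -> G h -> lox_axis h a b l ->
  exists k c d m, [/\ G k, lox_axis k c d m, hform c a != 0 & hform c b != 0].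
Proof.
move=> hG hGf hGg hnf hng hne hGh hax; apply: contrapT => hno.
have [ba bb hab _ _] := hax; have hh := sgU hG hGh.
have hba := hform_neq0C hab.
have pres (r : mx) : G r -> forall x, (x = a \/ x = b) ->
    (exists2 c, c != 0 & r *m x = c *: a) \/ (exists2 c, c != 0 & r *m x = c *: b).
  move=> hGr x hx; have hr := sgU hG hGr.
  have bx : on_bd x by case: hx => ->.
  have [x0 qx] := (on_bdP x).1 bx.
  have rx0 : r *m x != 0 by apply: unit_mul_neq0 => //; apply: U_unit.
  have qrx : qf (r *m x) <= 0 by rewrite qfU // qx.
  have [/eqP ha|ha] := boolP (hform (r *m x) a == 0).
    by left; apply: closure_orth_null.
  have [/eqP hb|hb] := boolP (hform (r *m x) b == 0).
    by right; apply: closure_orth_null.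
  exfalso; apply: hno; set k := r *m h *m invmx r.
  have hGk : G k by do !apply: sgM => //; apply: sgV.
  have hk := lox_axis_conj hh hr hax.
  case: hx ha hb => -> ha hb; first by exists k, (r *m a), (r *m b), l.
  by exists (invmx k), (r *m b), (r *m a), l^*; split=> //;
    [apply: sgV | apply: lox_axis_inv => //; apply: (sgU hG)].
have fixr (r : mx) : G r -> no_negative_fixed r ->
    forall z, fixbd r z <-> (exists2 c, c != 0 & z = c *: a) \/ (exists2 c, c != 0 & z = c *: b).
  move=> hGr hnr; have hr := sgU hG hGr.
  have [hfa hfb] : fixes r a /\ fixes r b.
    have [[s s0 hs]|[s s0 hs]] := pres r hGr a (or_introl erefl);
      have [[t t0 ht]|[t t0 ht]] := pres r hGr b (or_intror erefl).
    - case/eqP: hab; rewrite -(hformU _ _ hr) hs ht hformZl hformZr.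
      by have [_ ->] := ba; rewrite !mulr0.
    - by split; [exists s | exists t].
    - by case: (no_negative_fixed_no_swap hr hnr ba bb hab hs ht).
    - case/eqP: hab; rewrite -(hformU _ _ hr) hs ht hformZl hformZr.
      by have [_ ->] := bb; rewrite !mulr0.
  have [s hs] := hfa; have [t ht] := hfb.
  have hst := eigen_pair hr hs ht hab.
  have s0 : s != 0 by apply: (eigen_neq0 hr _ hs); case: ba.
  have ht' : t = (s^*)^-1.
    have sc0 : s^* != 0 by rewrite conjC_eq0.
    by apply: (mulfI sc0); rewrite mulfV // -[t]conjCK -conjM hst conjC1.
  have hs1 : nc s != 1.
    apply/eqP => hs1.
    have [y [hy hfy]] := unit_eigen_negative hr ba bb hab hs ht hs1.
    by apply: (hnr y hy); exists s.
  move=> z; split; last first.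
    have hpt x c : on_bd x -> fixes r x -> c != 0 -> fixbd r (c *: x).
      move=> [x0 qx] hfx c0; split; last exact: fixZ.
      by split; [rewrite scaler_eq0 negb_or c0 | rewrite hformZl hformZr qx !mulr0].
    by case=> [[c c0 ->]|[c c0 ->]]; apply: hpt.
  move=> [/on_bdP[z0 qz] hfz].
  have qz' : qf z <= 0 by rewrite qz.
  have [h1|h1|/eqP h1] := ltgtP 1 (nc s).
  - have hx : lox_axis r a b s by split=> //; split=> //; rewrite -ht'.
    exact: axis_fixcl hr hx z0 qz' hfz.
  - have hx : lox_axis r b a t.
      split=> //; first by rewrite ht' nc_dual invf_gt1 // nc_gt0.
      by split=> //; rewrite ht' dualK.
    by case: (axis_fixcl hr hx z0 qz' hfz); [right | left].
  - by rewrite eq_sym (negPf hs1) in h1.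
by apply: hne => z; rewrite (fixr f) // (fixr g).
Qed.

End LoxodromicExistence.

(** * Elements violating Condition A *)

Section ConditionA.
Variables (R : realType) (n : nat).
Local Notation C := (R[i]).
Local Notation nc := (@Normc.normc R).
Local Notation mx := ('M[C]_(n.+1)).
Local Notation vec := ('cV[C]_(n.+1)).

(** With [p = <a,b>], the vectors [a + i k p b] for natural [k] are null, because the cross terms
    are purely imaginary, and pairwise not proportional. *)
Lemma infinite_fix_of_equal_eigen (A : mx) (a b : vec) l : on_bd a -> on_bd b ->
  hform a b != 0 -> A *m a = l *: a -> A *m b = l *: b -> infinite_fix A.
Proof.
move=> ba bb hab ha hb s; have [[a0 qa] [b0 qb]] := (ba, bb).
set p := hform a b in hab.
pose y k : C := Complex 0 k%:R * p.
pose z k := a + y k *: b.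
have hz k : fixbd A (z k).
  split; last by exists l; rewrite mulmxDr -scalemxAr ha hb scalerDr !scalerA mulrC.
  split.
    apply/eqP => h; have : hform (z k) b = 0 by rewrite h hform0l.
    by rewrite hformDl hformZl qb mulr0 addr0 => /eqP; rewrite (negPf hab).
  rewrite !(hformDl, hformDr, hformZl, hformZr) qa qb (hformC a b) -/p /y conjM.
  have -> : (Complex 0 k%:R : C)^* = - Complex 0 k%:R.
    by apply/eqP; rewrite eq_complex /= oppr0 !eqxx.
  ring.
have hinj i j w : proportional (z i) w -> proportional (z j) w -> i = j.
  move=> [c [c0 hc]] [d [d0 hd]].
  have hcd : d *: z i = c *: z j by rewrite hc hd !scalerA mulrC.
  have hzb k : hform (z k) b = p by rewrite hformDl hformZl qb mulr0 addr0.
  have hza k : hform (z k) a = y k * p^*.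
    by rewrite hformDl hformZl qa add0r (hformC a b).
  have e1 : d = c.
    by apply: (mulIf hab); rewrite -[in LHS](hzb i) -(hzb j) -!hformZl hcd.
  have hpc : p^* != 0 by rewrite conjC_eq0.
  have e2 : y i = y j.
    apply: (mulfI d0); apply: (mulIf hpc).
    by rewrite -(mulrA d (y i)) -(mulrA d (y j)) -(hza i) -(hza j) -!hformZl hcd e1.
  by have [/eqP] := mulIf hab e2; rewrite eqr_nat => /eqP.
suff [K hK] : exists K, forall k, (K <= k)%N -> forall w, w \in s -> ~ proportional (z k) w.
  by exists (z K); split=> //; apply: hK.
elim: s => [|w s [K hK]]; first by exists 0%N.
have [[k0 hk0]|hno] := pselect (exists k, proportional (z k) w).
  exists (maxn K k0.+1) => k; rewrite geq_max => /andP[hKk hk0k] v.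
  rewrite inE => /orP[/eqP ->|]; last exact: hK.
  by move=> hk; move: hk0k; rewrite (hinj _ _ _ hk hk0) ltnn.
exists K => k hk v; rewrite inE => /orP[/eqP ->|]; last exact: hK.
by move=> hv; apply: hno; exists k.
Qed.

(** [f g] has the axis of [f] with eigenvalue [m l], so [f] and [f g] generate a discrete group, and
    it contains [g]. The powers of [g] are bounded on a negative eigenvector, hence bounded, so two
    of them agree up to a scalar. *)
Lemma finite_order_of_equal_eigen (G : mx -> Prop) (f g : mx) (a b : vec) l m :
  is_PU_subgroup G ->
  (forall f g, G f -> G g -> loxodromic f -> loxodromic g -> discrete (gen f g)) ->
  G f -> G g -> lox_axis f a b l -> nc m = 1 ->
  g *m a = m *: a -> g *m b = m *: b -> finite_order g.
Proof.
move=> hG hH hGf hGg hax hm hga hgb.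
have hf := sgU hG hGf; have hg := sgU hG hGg; have hfu := U_unit hf.
have [ba bb hab hl [ha hb]] := hax.
have [_ qa] := (on_bdP a).1 ba; have [_ qb] := (on_bdP b).1 bb.
have hfg := in_UM hf hg.
have m0 : m != 0 by rewrite -nc_gt0 hm.
have hmV : (m^*)^-1 = m.
  by apply: (mulIf (_ : m^* != 0)); rewrite ?conjC_eq0 // mulVf ?conjC_eq0 // -nc_sq hm expr1n.
have hax' : lox_axis (f *m g) a b (m * l).
  split=> //; first by rewrite ncM hm mul1r.
  split; first by rewrite -mulmxA hga -scalemxAr ha scalerA.
  by rewrite -mulmxA hgb -scalemxAr hb scalerA conjM invfM hmV.
have hS := gen_subgroup hf hfg.
have hd : discrete (gen f (f *m g)).
  apply: hH => //; first exact: sgM.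
    exact: axis_loxodromic hf hax.
  exact: axis_loxodromic hfg hax'.
have hSg : gen f (f *m g) g.
  have := sgM hS (sgV hS (@gen_l _ _ f (f *m g))) (@gen_r _ _ f (f *m g)).
  by rewrite mulKmx.
have hz := negative_comb qa qb hab; set z := a + _ in hz.
have hgz : g *m z = m *: z.
  by rewrite mulmxDr -scalemxAr hga hgb scalerDr !scalerA mulrC.
have [M hM] := U_bounded_of_negative (mn z) hz.
have [i [j [hij hp]]] : exists i j, (i < j)%N /\ pu_eq (g ^+ j) (g ^+ i).
  apply: (discrete_bounded_repeats hS hd (M := M)) => k; first exact: (sgX hS k hSg).
  by apply: (hM _ (in_UX k hg)); rewrite (eigenX k hgz) mnZ ncX hm expr1n mul1r.
exists (j - i)%N; split; first by rewrite subn_gt0.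
have [c [hc hE]] := hp; exists c; split=> //.
have hgi : g ^+ i \in unitmx by apply: U_unit; exact: in_UX.
have : g ^+ i *m g ^+ (j - i) = c *: g ^+ i.
  by rewrite -hE -{2}(subnKC (ltnW hij)) exprD.
move=> h; rewrite -[g ^+ (j - i)](mulKmx hgi) h -scalemxAr mulVmx //.
Qed.

(** Choosing elements ever closer to the identity gives convergence; distinctness in the projective
    group requires each to be closer than every unit multiple of the earlier ones. *)
Lemma sequence_to_identity (Q : mx -> Prop) :
  (forall e : R, 0 < e -> exists g, [/\ Q g, mn (g - 1%:M) < e & ~ pu_eq g 1]) ->
  exists g : nat -> mx, [/\ forall i, Q (g i),
    forall i j, i <> j -> ~ pu_eq (g i) (g j) & converges_to_I g].
Proof.
move=> h.
have hstep (e : R) : exists ge : mx * R, 0 < e ->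
    [/\ Q ge.1, mn (ge.1 - 1%:M) < e, 0 < ge.2 & ~ pu_close ge.1 1 ge.2].
  have [e0|e0] := ltP 0 e; last by exists (1%:M, 0).
  have [g [hQ hg hne]] := h e e0.
  have [d [d0 hd]] : exists d : R, 0 < d /\ ~ pu_close g 1 d.
    apply: contrapT => hno; apply: hne; apply: pu_close_all => d d0.
    by apply: contrapT => hc; apply: hno; exists d.
  by exists (g, d).
have [F hF] := choice hstep.
(* Each radius is at most half the previous one, for convergence, and at most a radius at which the
   previous element is not close to the identity, for distinctness. *)
pose ep := fix ep (k : nat) : R := if k is k'.+1
  then Num.min (ep k' / 2) (F (ep k')).2 else 1.
pose g k := (F (ep k)).1.
have ep0 k : 0 < ep k.
  elim: k => [|k IH] /=; first exact: ltr01.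
  by have [_ _ h2 _] := hF _ IH; rewrite lt_min divr_gt0.
have epS k : ep k.+1 <= ep k / 2 by rewrite /= ge_min lexx.
have ep_half k : ep k <= 2^-1 ^+ k.
  elim: k => [|k IH]; first by rewrite expr0.
  by apply: (le_trans (epS k)); rewrite exprSr ler_wpM2r // invr_ge0.
have epF i j : (i < j)%N -> ep j <= (F (ep i)).2.
  elim: j => [//|j IH]; rewrite ltnS leq_eqVlt => /orP[/eqP ->|hij].
    by rewrite /= ge_min lexx orbT.
  apply: le_trans (IH hij); apply: (le_trans (epS j)).
  by rewrite ler_pdivrMr // ler_peMr ?ler1n // ltW.
have hg k := hF _ (ep0 k).
have hlt i j : (i < j)%N -> ~ pu_eq (g i) (g j).
  move=> hij [c [hc hE]]; have [_ _ _ hi] := hg i; apply: hi; rewrite -/(g i).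
  have [_ hj _ _] := hg j.
  have [d [hd hcl]] : pu_close (g j) 1 (F (ep i)).2.
    by apply: pu_close_of_near; apply: (lt_le_trans hj); apply: epF.
  exists (d / c); split.
    by rewrite normrM normfV hd hc invr1 mulr1.
  move=> x y; rewrite hE mxE mulrA divfK ?hcl //.
  by rewrite -normr_gt0 hc.
exists g; split.
- by move=> i; have [] := hg i.
- move=> i j hij; have [hl|hl|hl] := ltngtP i j; [exact: hlt | | by []].
  move=> [c [hc hE]]; apply: (hlt j i hl); exists c^-1; split.
    by rewrite normfV hc invr1.
  by rewrite hE scalerA mulVf ?scale1r // -normr_gt0 hc.
- move=> e e0; have := archi_boundP (x := e^-1) (ltW _); rewrite invr_gt0 => /(_ e0).
  set K := Num.bound _ => hK; exists K => i hi; apply: pu_close_of_near.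
  have [_ h1 _ _] := hg i; apply: (lt_trans h1); apply: (le_lt_trans (ep_half i)).
  rewrite exprVn -[e]invrK ltf_pV2 ?posrE ?invr_gt0 ?exprn_gt0 //.
  apply: (lt_le_trans hK); rewrite -natrX ler_nat.
  by apply: (leq_trans hi); rewrite ltnW // ltn_expl.
Qed.

End ConditionA.

(** * Discreteness from pairs of loxodromic elements *)

Theorem theorem3p3 (R : realType) (n : nat) (G : 'M[R[i]]_(n.+1) -> Prop) :
  (1 <= n)%N ->
  is_PU_subgroup G -> non_elementary G -> conditionA G ->
  discrete G <->
  (forall f g, G f -> G g -> loxodromic f -> loxodromic g -> discrete (gen f g)).
Proof.
move=> _ hG [f [g [hGf [hGg [hef [heg [hif [hig hne]]]]]]]] hA; split.
  (* [G] is one of the subgroups over which [gen] intersects, so the generated group lies in [G] and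
     inherits its discreteness. *)
  move=> hd f1 f2 h1 h2 _ _ B hB; have [e [e0 he]] := hd B (hB G hG h1 h2).
  by exists e; split=> // A hAS hc; apply: he => //; apply: hAS.
move=> hH; apply: contrapT => hnd; apply: hA.
(* Infinite order supplies the nontriviality that [elliptic] demands. *)
have hno (r : 'M[R[i]]_(n.+1)) : ~ elliptic r -> infinite_order r -> no_negative_fixed r.
  move=> he hi z hz hf; apply: he; split; last by exists z.
  by move=> hp; apply: hi; exists 1%N; rewrite expr1.
have hnf := hno f hef hif; have hng := hno g heg hig.
have [f1 [a [b [l [hG1 hax1]]]]] := exists_lox_axis hG hGf hGg hnf hng hne.
have [f2 [c [d [m [hG2 hax2 hca hcb]]]]] :=
  exists_second_lox_axis hG hGf hGg hnf hng hne hG1 hax1.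
have [d1 [d10 hd1]] := lox_small_fix_axis hG hH hG1 hax1.
have [d2 [d20 hd2]] := lox_small_fix_axis hG hH hG2 hax2.
have [ba bb hab _ _] := hax1.
have [|u [hu1 hu2 hu3]] := @sequence_to_identity R n
  (fun r => G r /\ finite_order r /\ infinite_fix r); last by exists u.
move=> e e0.
have [|r [hGr hr hrn]] := not_discrete_near1 hG hnd (e := Num.min e (Num.min d1 d2)).
  by rewrite !lt_min e0 d10.
move: hr; rewrite !lt_min => /and3P[hre hr1 hr2].
(* [r] fixes both ends of the first axis and the end [c] of the second; these three pair
   nontrivially, so [r] has one unit eigenvalue on [a] and [b]. *)
have [[p hp] [q hq]] := hd1 r hGr hr1; have [hrc _] := hd2 r hGr hr2.
have [hp1 hqp] := three_fixed_scalar (sgU hG hGr) hab hca hcb hp hq hrc.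
rewrite hqp in hq.
exists r; split=> //; split=> //; split.
  exact: finite_order_of_equal_eigen hG hH hG1 hGr hax1 hp1 hp hq.
exact: infinite_fix_of_equal_eigen ba bb hab hp hq.
Qed.
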